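(* Every continuous unitary representation of $\widetilde{\mathrm{SL}}_2(\mathbb R)$ extends to an (anti-)unitary representation of the graded group $\widetilde{\mathrm{GL}}_2(\mathbb R):=\widetilde{\mathrm{SL}}_2(\mathbb R)\rtimes\{\mathbf 1,\tau_G\}$, where $\tau_G$ is the involutive automorphism of $\widetilde{\mathrm{SL}}_2(\mathbb R)$ integrating the Lie algebra automorphism $\tau\begin{pmatrix}a&b\\c&d\end{pmatrix}=\begin{pmatrix}a&-b\\-c&d\end{pmatrix}$ of $\mathfrak{sl}_2(\mathbb R)$.
   Context: $\widetilde{\mathrm{SL}}_2(\mathbb R)$ is the universal covering group of $\mathrm{SL}_2(\mathbb R)$. The group $\widetilde{\mathrm{GL}}_2(\mathbb R)$ is graded with $\tau_G$ (and the coset $\widetilde{\mathrm{SL}}_2(\mathbb R)\tau_G$) of degree $-1$; an (anti-)unitary representation is a continuous homomorphism into the group of unitary and antiunitary operators on a Hilbert space sending exactly the elements of degree $-1$ to antiunitary operators. *)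

(* Defs.v *)
From Stdlib Require Import Reals Lra.
From Coquelicot Require Import Coquelicot.
Open Scope R_scope.

Record HilbertSpace := {
  hcar :> Type;
  hadd : hcar -> hcar -> hcar;
  hzero : hcar;
  hopp : hcar -> hcar;
  hscal : C -> hcar -> hcar;
  hinner : hcar -> hcar -> C;
  hadd_assoc : forall x y z, hadd x (hadd y z) = hadd (hadd x y) z;
  hadd_comm : forall x y, hadd x y = hadd y x;
  hadd_zero : forall x, hadd x hzero = x;
  hadd_opp : forall x, hadd x (hopp x) = hzero;
  hscal_one : forall x, hscal (RtoC 1) x = x;
  hscal_assoc : forall a b x, hscal a (hscal b x) = hscal (Cmult a b) x;
  hscal_distr_l : forall a x y, hscal a (hadd x y) = hadd (hscal a x) (hscal a y);
  hscal_distr_r : forall a b x, hscal (Cplus a b) x = hadd (hscal a x) (hscal b x);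
  hinner_add_l : forall x y z, hinner (hadd x y) z = Cplus (hinner x z) (hinner y z);
  hinner_scal_l : forall a x y, hinner (hscal a x) y = Cmult a (hinner x y);
  hinner_conj : forall x y, hinner y x = Cconj (hinner x y);
  hinner_real : forall x, Im (hinner x x) = 0;
  hinner_pos : forall x, 0 <= Re (hinner x x);
  hinner_def : forall x, hinner x x = RtoC 0 -> x = hzero;
  hcomplete : forall u : nat -> hcar,
    (forall eps, 0 < eps -> exists N, forall m n, (N <= m)%nat -> (N <= n)%nat ->
        sqrt (Re (hinner (hadd (u m) (hopp (u n))) (hadd (u m) (hopp (u n))))) < eps) ->
    exists l, forall eps, 0 < eps -> exists N, forall n, (N <= n)%nat ->
        sqrt (Re (hinner (hadd (u n) (hopp l)) (hadd (u n) (hopp l)))) < eps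
}.

Definition hnorm (H : HilbertSpace) (x : H) : R :=
  sqrt (Re (hinner H x x)).

Definition hdist (H : HilbertSpace) (x y : H) : R :=
  hnorm H (hadd H x (hopp H y)).

Definition unitary (H : HilbertSpace) (U : H -> H) : Prop :=
  (forall x y, U (hadd H x y) = hadd H (U x) (U y)) /\
  (forall (a : C) x, U (hscal H a x) = hscal H a (U x)) /\
  (forall y, exists x, U x = y) /\
  (forall x y, hinner H (U x) (U y) = hinner H x y).

Definition antiunitary (H : HilbertSpace) (U : H -> H) : Prop :=
  (forall x y, U (hadd H x y) = hadd H (U x) (U y)) /\
  (forall (a : C) x, U (hscal H a x) = hscal H (Cconj a) (U x)) /\
  (forall y, exists x, U x = y) /\
  (forall x y, hinner H (U x) (U y) = Cconj (hinner H x y)).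

(* Explicit model of the universal covering group of SL_2(R):           *)
(* pairs (g, theta), g = [[a,b],[c,d]] in SL_2(R), theta a real number  *)
(* that is an argument of j(g,i) = c i + d.                             *)
Record SLt := mkSLt { sa : R; sb : R; sc : R; sd : R; sth : R }.

Definition inSLt (g : SLt) : Prop :=
  sa g * sd g - sb g * sc g = 1 /\
  sd g = sqrt (sc g ^ 2 + sd g ^ 2) * cos (sth g) /\
  sc g = sqrt (sc g ^ 2 + sd g ^ 2) * sin (sth g).

(* principal argument, valid off the closed negative real half-line *)
Definition Arg (z : C) : R := 2 * atan (Im z / (Cmod z + Re z)).

Definition jfac (g : SLt) (z : C) : C :=
  Cplus (Cmult (RtoC (sc g)) z) (RtoC (sd g)).

Definition moeb (g : SLt) (z : C) : C :=
  Cdiv (Cplus (Cmult (RtoC (sa g)) z) (RtoC (sb g))) (jfac g z).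

(* group law: theta-part follows the cocycle j(g1 g2, i) = j(g1, g2 i) j(g2, i),
   with the branch of arg j(g1, .) continued from i over the upper half-plane *)
Definition slt_mul (g h : SLt) : SLt :=
  mkSLt (sa g * sa h + sb g * sc h) (sa g * sb h + sb g * sd h)
        (sc g * sa h + sd g * sc h) (sc g * sb h + sd g * sd h)
        (sth g + sth h + Arg (Cdiv (jfac g (moeb h Ci)) (jfac g Ci))).

Definition slt_one : SLt := mkSLt 1 0 0 1 0.

(* tau_G: lift of g |-> diag(1,-1) g diag(1,-1), integrating
   tau [[a,b],[c,d]] = [[a,-b],[-c,d]] on sl_2(R) *)
Definition tauG (g : SLt) : SLt :=
  mkSLt (sa g) (- sb g) (- sc g) (sd g) (- sth g).

Definition slt_dist (g h : SLt) : R :=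
  Rabs (sa g - sa h) + Rabs (sb g - sb h) + Rabs (sc g - sc h)
  + Rabs (sd g - sd h) + Rabs (sth g - sth h).

(* Graded group GL~_2(R) = SL~_2(R) x| {1, tau_G}: (g, false) ~ g,
   (g, true) ~ g tau_G  (degree -1). *)
Definition GLt := (SLt * bool)%type.

Definition inGLt (x : GLt) : Prop := inSLt (fst x).

Definition glt_mul (x y : GLt) : GLt :=
  (slt_mul (fst x) (if snd x then tauG (fst y) else fst y), xorb (snd x) (snd y)).

Definition strongly_continuous (H : HilbertSpace) (U : SLt -> H -> H) : Prop :=
  forall g (v : H), inSLt g -> forall eps, 0 < eps -> exists delta, 0 < delta /\
    forall h, inSLt h -> slt_dist h g < delta -> hdist H (U h v) (U g v) < eps.

Definition unitary_rep (H : HilbertSpace) (U : SLt -> H -> H) : Prop :=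
  (forall g, inSLt g -> unitary H (U g)) /\
  (forall g h (v : H), inSLt g -> inSLt h -> U (slt_mul g h) v = U g (U h v)) /\
  strongly_continuous H U.

(* continuous (anti-)unitary representation of the graded group GL~_2(R):
   degree -1 elements (g, true) go to antiunitaries, others to unitaries;
   topology = product of SL~_2(R) with the discrete group {1, tau_G}. *)
Definition antiunitary_rep (H : HilbertSpace) (V : GLt -> H -> H) : Prop :=
  (forall g, inSLt g -> unitary H (V (g, false)) /\ antiunitary H (V (g, true))) /\
  (forall x y (v : H), inGLt x -> inGLt y -> V (glt_mul x y) v = V x (V y v)) /\
  (forall s, strongly_continuous H (fun g => V (g, s))).

(* Main.v *)
(* The anti-automorphism g |-> tau(g)^-1 fixes the one-parameter group K = {k_t} over the
   rotations and maps a diagonal a to a^-1 = k_{pi/2} a k_{-pi/2}. Hence, if v lies in a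
   K-invariant subspace N with <U(a) W(t) x, W(t) y> = <U(a) x, y> for all x, y in N, where
   W(t) = U(k_t), the decomposition G = K A K gives <U(tau g) v, v> = conj <U(g) v, v>, and
   U(g) v |-> U(tau g) v is a well-defined antiunitary involution of the cyclic subspace of v.

   Such an N exists in every nonzero closed K-invariant subspace: K modulo the center is
   compact, so t |-> <U(a) W(t) x, W(t) y> has period pi, and it must be constant as soon as
   the generator of W restricted to N has spectrum in a sufficiently short interval. The
   spectral cut producing N only needs the absolute value of a bounded symmetric operator.

   Zorn's lemma for sets S of vectors with <U(tau g) v, w> = conj <U(g) v, w> for v, w in S
   then yields the conjugation on the whole space. *)

Require Import Defs.
From Stdlib Require Import Reals Lra Lia ClassicalEpsilon.
From Coquelicot Require Import Coquelicot.
From mathcomp Require classical_sets.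

(** * Hilbert space preliminaries *)

(** Why a short spectrum suffices: the frequencies of [t |-> <U(a) W(t) x, W(t) y>] are differences
    of spectral values of [x] and [y], and the period pi leaves only even integers, so a spectrum of
    length below 2 leaves the frequency 0. The argument is made discrete: the period is halved again
    and again, and invariance passes from [n * s] to [s] when [W s] is close to a scalar. Infinitely
    many halvings are needed, but an infinite sequence of cuts may end in the zero subspace. Hence
    one cut makes the generator bounded, after which all [W (PI / 2 ^ m)] with large [m] are close
    to 1 at once, and only finitely many further cuts are left. The conjugation on the whole space
    also requires the symmetry of mixed matrix coefficients. The orthogonal complement of what is
    already reached is invariant, so a new vector found there has mixed coefficients 0. *)

Section Hilbert.

Context {H : HilbertSpace}.

(** The real part determines [hinner], since the imaginary part is [rip x (hI y)]; it turns vector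
    identities into real ones that [lra] and [field] decide. *)
Definition rip (x y : H) : R := Re (hinner H x y).
Definition rscal (r : R) (x : H) : H := hscal H (RtoC r) x.
Definition hI (x : H) : H := hscal H Ci x.

Lemma hinner_add_r (x y z : H) :
  hinner H z (hadd H x y) = Cplus (hinner H z x) (hinner H z y).
Proof.
rewrite hinner_conj, hinner_add_l, (hinner_conj H x z), (hinner_conj H y z).
apply Cplus_conj.
Qed.

Lemma hinner_scal_r (a : C) (x y : H) :
  hinner H x (hscal H a y) = Cmult (Cconj a) (hinner H x y).
Proof.
rewrite hinner_conj, hinner_scal_l, (hinner_conj H y x). apply Cmult_conj.
Qed.

Lemma rip_sym (x y : H) : rip x y = rip y x.
Proof. unfold rip. rewrite (hinner_conj H x y). reflexivity. Qed.

Lemma rip_add_l (x y z : H) : rip (hadd H x y) z = rip x z + rip y z.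
Proof. unfold rip. rewrite hinner_add_l. reflexivity. Qed.

Lemma rip_add_r (x y z : H) : rip z (hadd H x y) = rip z x + rip z y.
Proof. unfold rip. rewrite hinner_add_r. reflexivity. Qed.

Lemma rip_zero_l (x : H) : rip (hzero H) x = 0.
Proof.
generalize (rip_add_l (hzero H) (hzero H) x). rewrite hadd_zero. lra.
Qed.

Lemma rip_zero_r (x : H) : rip x (hzero H) = 0.
Proof. rewrite rip_sym. apply rip_zero_l. Qed.

Lemma rip_opp_l (x y : H) : rip (hopp H x) y = - rip x y.
Proof.
generalize (rip_add_l x (hopp H x) y). rewrite hadd_opp, rip_zero_l. lra.
Qed.

Lemma rip_opp_r (x y : H) : rip x (hopp H y) = - rip x y.
Proof. rewrite rip_sym, rip_opp_l, rip_sym. reflexivity. Qed.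

Lemma rip_rscal_l (r : R) (x y : H) : rip (rscal r x) y = r * rip x y.
Proof. unfold rip, rscal. rewrite hinner_scal_l. unfold Re, Im; simpl. ring. Qed.

Lemma rip_rscal_r (r : R) (x y : H) : rip x (rscal r y) = r * rip x y.
Proof. rewrite rip_sym, rip_rscal_l, rip_sym. reflexivity. Qed.

Lemma rip_hI_l (x y : H) : rip (hI x) y = - rip x (hI y).
Proof. unfold rip, hI. rewrite hinner_scal_l, hinner_scal_r. unfold Re, Im; simpl. ring. Qed.

Lemma Im_hinner (x y : H) : Im (hinner H x y) = rip x (hI y).
Proof. unfold rip, hI. rewrite hinner_scal_r. unfold Re, Im; simpl. ring. Qed.

Lemma rip_pos (x : H) : 0 <= rip x x.
Proof. apply hinner_pos. Qed.

Lemma rip_def (x : H) : rip x x = 0 -> x = hzero H.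
Proof.
intros E. apply hinner_def. generalize (hinner_real H x).
unfold rip in E. destruct (hinner H x x); simpl in *. intros ->. subst. reflexivity.
Qed.

Lemma hsub_eq (x y : H) : hadd H x (hopp H y) = hzero H -> x = y.
Proof.
intros E.
rewrite <- (hadd_zero H x), <- (hadd_opp H y), (hadd_comm H y), hadd_assoc, E.
rewrite hadd_comm. apply hadd_zero.
Qed.

Lemma hext (x y : H) : (forall z, rip x z = rip y z) -> x = y.
Proof.
intros E. apply hsub_eq, rip_def.
rewrite rip_add_l, rip_opp_l, E. ring.
Qed.

Lemma hinner_ext (x y x' y' : H) :
  rip x y = rip x' y' -> rip x (hI y) = rip x' (hI y') ->
  hinner H x y = hinner H x' y'.
Proof.
rewrite <- !Im_hinner. unfold rip.
destruct (hinner H x y), (hinner H x' y'); simpl. intros -> ->. reflexivity.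
Qed.

End Hilbert.

Create HintDb rip.
#[export] Hint Rewrite @rip_add_l @rip_add_r @rip_opp_l @rip_opp_r @rip_zero_l
  @rip_zero_r @rip_rscal_l @rip_rscal_r @rip_hI_l : rip.

Ltac hvec := apply hext; intros; autorewrite with rip; try field.

(** * Norm, convergence and closed subspaces *)

Section Norm.

Context {H : HilbertSpace}.

Definition hsub (x y : H) : H := hadd H x (hopp H y).

Lemma hscal_split (a : C) (x : H) :
  hscal H a x = hadd H (rscal (Re a) x) (rscal (Im a) (hI x)).
Proof.
unfold rscal, hI. rewrite hscal_assoc, <- hscal_distr_r. f_equal.
destruct a as [a b]. apply injective_projections; simpl; ring.
Qed.

Lemma rip_hI_hI (x y : H) : rip (hI x) (hI y) = rip x y.
Proof. unfold rip, hI. rewrite hinner_scal_l, hinner_scal_r. unfold Re, Im; simpl. ring. Qed.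

Lemma hI_hI (x : H) : hI (hI x) = hopp H x.
Proof. apply hext. intros. rewrite rip_hI_l, rip_hI_hI, rip_opp_l. reflexivity. Qed.

Lemma hnorm_sqr (x : H) : hnorm H x * hnorm H x = rip x x.
Proof. apply sqrt_sqrt, rip_pos. Qed.

Lemma hnorm_ge0 (x : H) : 0 <= hnorm H x.
Proof. apply sqrt_pos. Qed.

Lemma hnorm_eq (x y : H) : rip x x = rip y y -> hnorm H x = hnorm H y.
Proof. unfold hnorm. intros E. f_equal. exact E. Qed.

Lemma hnorm_le (x y : H) : rip x x <= rip y y -> hnorm H x <= hnorm H y.
Proof. apply sqrt_le_1_alt. Qed.

Lemma hnorm_le_scal (x y : H) (r : R) :
  0 <= r -> rip x x <= r * r * rip y y -> hnorm H x <= r * hnorm H y.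
Proof.
intros Hr E. rewrite <- !hnorm_sqr in E.
generalize (hnorm_ge0 x) (hnorm_ge0 y). intros.
apply Rsqr_incr_0; unfold Rsqr; nra.
Qed.

Lemma rip_le_scal (x y : H) (r : R) :
  hnorm H x <= r * hnorm H y -> rip x x <= r * r * rip y y.
Proof.
intros E. rewrite <- !hnorm_sqr. generalize (hnorm_ge0 x). intros. nra.
Qed.

Lemma rip_le (x y : H) : hnorm H x <= hnorm H y -> rip x x <= rip y y.
Proof. intros E. generalize (rip_le_scal x y 1). lra. Qed.

Lemma cauchy_schwarz (x y : H) : Rabs (rip x y) <= hnorm H x * hnorm H y.
Proof.
generalize (hnorm_ge0 x) (hnorm_ge0 y) (hnorm_sqr x) (hnorm_sqr y). intros nx ny ex ey.
assert (D : rip x y * rip x y <= rip x x * rip y y).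
{ destruct (Req_dec (rip y y) 0) as [E|E].
  - rewrite (rip_def y E), !rip_zero_r. lra.
  - assert (P := rip_pos (hsub x (rscal (rip x y / rip y y) y))).
    unfold hsub in P. autorewrite with rip in P. rewrite (rip_sym y x) in P.
    assert (0 < rip y y) by (generalize (rip_pos y); lra).
    apply Rmult_le_compat_r with (r := rip y y) in P; [|lra].
    field_simplify in P; [|lra]. nra. }
apply Rsqr_incr_0; unfold Rsqr; [|apply Rabs_pos|nra].
rewrite <- Rabs_mult, Rabs_pos_eq by nra. nra.
Qed.

Lemma hnorm_add (x y : H) : hnorm H (hadd H x y) <= hnorm H x + hnorm H y.
Proof.
generalize (hnorm_ge0 x) (hnorm_ge0 y) (hnorm_sqr x) (hnorm_sqr y). intros nx ny ex ey.
apply Rsqr_incr_0; unfold Rsqr; [|apply hnorm_ge0|lra].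
rewrite hnorm_sqr. autorewrite with rip.
generalize (cauchy_schwarz x y) (Rle_abs (rip x y)). rewrite (rip_sym y x). nra.
Qed.

Lemma hnorm_opp (x : H) : hnorm H (hopp H x) = hnorm H x.
Proof. apply hnorm_eq. autorewrite with rip. ring. Qed.

Lemma hnorm_hI (x : H) : hnorm H (hI x) = hnorm H x.
Proof. apply hnorm_eq. apply rip_hI_hI. Qed.

Lemma hnorm_rscal (r : R) (x : H) : hnorm H (rscal r x) = Rabs r * hnorm H x.
Proof.
unfold hnorm. change (sqrt (rip (rscal r x) (rscal r x)) = Rabs r * sqrt (rip x x)).
autorewrite with rip. rewrite <- Rmult_assoc, sqrt_mult_alt by nra.
f_equal. apply sqrt_Rsqr_abs.
Qed.

Lemma hnorm_zero : hnorm H (hzero H) = 0.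
Proof.
unfold hnorm. change (sqrt (rip (hzero H) (hzero H)) = 0).
rewrite rip_zero_l. apply sqrt_0.
Qed.

Lemma hnorm_def (x : H) : hnorm H x = 0 -> x = hzero H.
Proof. intros E. apply rip_def. rewrite <- hnorm_sqr, E. ring. Qed.

Lemma hnorm_sub_sym (x y : H) : hnorm H (hsub x y) = hnorm H (hsub y x).
Proof. apply hnorm_eq. unfold hsub. autorewrite with rip. ring. Qed.

Lemma hnorm_sub_triangle (x y z : H) :
  hnorm H (hsub x z) <= hnorm H (hsub x y) + hnorm H (hsub y z).
Proof.
replace (hsub x z) with (hadd H (hsub x y) (hsub y z)) by (unfold hsub; hvec).
apply hnorm_add.
Qed.

Lemma hnorm_hscal (a : C) (x : H) : hnorm H (hscal H a x) = Cmod a * hnorm H x.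
Proof.
rewrite hscal_split. unfold hnorm at 1.
change (Re (hinner H ?u ?u)) with (rip u u).
rewrite !rip_add_l, !rip_add_r, !rip_rscal_l, !rip_rscal_r, rip_hI_hI, rip_hI_l.
assert (E : rip x (hI x) = 0) by (generalize (rip_hI_l x x); rewrite (rip_sym (hI x)); lra).
rewrite E. unfold Cmod, hnorm.
rewrite <- sqrt_mult_alt by (simpl; nra). f_equal.
change (Re (hinner H x x)) with (rip x x). destruct a; simpl; ring.
Qed.

Definition tends (u : nat -> H) (l : H) : Prop :=
  is_lim_seq (fun n => hnorm H (hsub (u n) l)) 0.

Lemma tends_dom (u : nat -> H) (l : H) (a : nat -> R) :
  (forall n, hnorm H (hsub (u n) l) <= a n) -> is_lim_seq a 0 -> tends u l.
Proof.
intros D A. apply (is_lim_seq_le_le (fun _ => 0) _ a); [|apply is_lim_seq_const|exact A].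
intros n. split; [apply hnorm_ge0|apply D].
Qed.

Lemma tends_spec (u : nat -> H) (l : H) :
  tends u l <-> (forall eps, 0 < eps ->
    exists N, forall n, (N <= n)%nat -> hnorm H (hsub (u n) l) < eps).
Proof.
unfold tends. split.
- intros T eps He. apply is_lim_seq_spec in T.
  destruct (T (mkposreal eps He)) as [N HN]. exists N. intros n Hn.
  specialize (HN n Hn). simpl in HN. apply Rabs_def2 in HN. lra.
- intros T. apply is_lim_seq_spec. intros [eps He]. destruct (T eps He) as [N HN].
  exists N. intros n Hn. specialize (HN n Hn). simpl.
  rewrite Rminus_0_r, Rabs_pos_eq; [exact HN|apply hnorm_ge0].
Qed.

Lemma tends_const (l : H) : tends (fun _ => l) l.
Proof.
apply tends_dom with (fun _ => 0); [|apply is_lim_seq_const].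
intros _. unfold hsub. rewrite hadd_opp, hnorm_zero. lra.
Qed.

Lemma tends_ext (u v : nat -> H) (l : H) :
  (forall n, u n = v n) -> tends u l -> tends v l.
Proof. intros E. apply is_lim_seq_ext. intros n. rewrite E. reflexivity. Qed.

Lemma tends_add (u v : nat -> H) (l m : H) :
  tends u l -> tends v m -> tends (fun n => hadd H (u n) (v n)) (hadd H l m).
Proof.
intros A B. apply tends_dom with (fun n => hnorm H (hsub (u n) l) + hnorm H (hsub (v n) m)).
- intros n. replace (hsub (hadd H (u n) (v n)) (hadd H l m))
    with (hadd H (hsub (u n) l) (hsub (v n) m)) by (unfold hsub; hvec).
  apply hnorm_add.
- replace (Finite 0) with (Finite (0 + 0)) by (f_equal; ring).
  apply is_lim_seq_plus'; assumption.
Qed.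

Lemma tends_lip (T : H -> H) (c : R) (u : nat -> H) (l : H) :
  (forall n, hnorm H (hsub (T (u n)) (T l)) <= c * hnorm H (hsub (u n) l)) ->
  tends u l -> tends (fun n => T (u n)) (T l).
Proof.
intros L A. apply tends_dom with (fun n => c * hnorm H (hsub (u n) l)); [exact L|].
replace (Finite 0) with (Rbar_mult c 0) by (simpl; f_equal; ring).
apply is_lim_seq_scal_l. exact A.
Qed.

Lemma tends_hscal (a : C) (u : nat -> H) (l : H) :
  tends u l -> tends (fun n => hscal H a (u n)) (hscal H a l).
Proof.
apply tends_lip with (c := Cmod a). intros n. right. rewrite <- hnorm_hscal. f_equal.
unfold hsub. rewrite hscal_distr_l. f_equal.
rewrite !hscal_split. unfold hI. rewrite !hscal_split. hvec.
Qed.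

Lemma tends_opp (u : nat -> H) (l : H) :
  tends u l -> tends (fun n => hopp H (u n)) (hopp H l).
Proof.
apply tends_lip with (c := 1). intros n. right.
rewrite Rmult_1_l, <- hnorm_opp. f_equal. unfold hsub. hvec.
Qed.

Lemma tends_rip (u v : nat -> H) (l m : H) :
  tends u l -> tends v m -> is_lim_seq (fun n => rip (u n) (v n)) (rip l m).
Proof.
intros A B.
apply is_lim_seq_ext with (fun n => rip l m +
   (rip (hsub (u n) l) (hsub (v n) m) + rip l (hsub (v n) m) + rip (hsub (u n) l) m)).
{ intros n. unfold hsub. autorewrite with rip. ring. }
replace (rip l m) with (rip l m + 0) at 1 by ring.
apply is_lim_seq_plus'; [apply is_lim_seq_const|].
apply is_lim_seq_abs_0.
apply is_lim_seq_le_le with (fun _ => 0) (fun n =>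
  hnorm H (hsub (u n) l) * hnorm H (hsub (v n) m)
  + hnorm H l * hnorm H (hsub (v n) m) + hnorm H (hsub (u n) l) * hnorm H m).
- intros n. split; [apply Rabs_pos|].
  eapply Rle_trans; [apply Rabs_triang|]. apply Rplus_le_compat; [|apply cauchy_schwarz].
  eapply Rle_trans; [apply Rabs_triang|].
  apply Rplus_le_compat; apply cauchy_schwarz.
- apply is_lim_seq_const.
- replace (Finite 0) with (Finite (0 * 0 + hnorm H l * 0 + 0 * hnorm H m))
    by (f_equal; ring).
  apply is_lim_seq_plus'; [apply is_lim_seq_plus'|]; apply is_lim_seq_mult';
    assumption || apply is_lim_seq_const.
Qed.

Lemma tends_unique (u : nat -> H) (l m : H) : tends u l -> tends u m -> l = m.
Proof.
intros A B. apply hext. intros z.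
generalize (is_lim_seq_unique _ _ (tends_rip _ _ _ _ A (tends_const z))).
rewrite (is_lim_seq_unique _ _ (tends_rip _ _ _ _ B (tends_const z))).
intros E. injection E. auto.
Qed.

Lemma tends_norm_le (u : nat -> H) (l : H) (c : R) :
  tends u l -> (forall n, hnorm H (u n) <= c) -> hnorm H l <= c.
Proof.
intros A B.
assert (0 <= c) by (eapply Rle_trans; [apply hnorm_ge0|apply (B O)]).
apply Rsqr_incr_0; unfold Rsqr; [|apply hnorm_ge0|assumption].
rewrite hnorm_sqr.
apply (is_lim_seq_le (fun n => rip (u n) (u n)) (fun _ => c * c) (rip l l) (c * c)).
- intros n. rewrite <- hnorm_sqr. generalize (hnorm_ge0 (u n)) (B n). nra.
- apply tends_rip; assumption.
- apply is_lim_seq_const.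
Qed.

Lemma tends_incr_n (u : nat -> H) (l : H) (k : nat) :
  tends u l -> tends (fun n => u (n + k)%nat) l.
Proof. intros A. apply (is_lim_seq_incr_n (fun n => hnorm H (hsub (u n) l))). exact A. Qed.

Definition hcauchy (u : nat -> H) : Prop :=
  forall eps, 0 < eps -> exists N, forall m n, (N <= m)%nat -> (N <= n)%nat ->
    hnorm H (hsub (u m) (u n)) < eps.

Lemma cauchy_tends (u : nat -> H) : hcauchy u -> exists l, tends u l.
Proof.
intros A. destruct (hcomplete H u A) as [l L]. exists l. apply tends_spec. exact L.
Qed.

Lemma tends_cauchy (u : nat -> H) (l : H) : tends u l -> hcauchy u.
Proof.
intros T eps He. destruct (proj1 (tends_spec u l) T (eps / 2)) as [N HN]; [lra|].
exists N. intros m n Hm Hn. generalize (hnorm_sub_triangle (u m) l (u n)).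
rewrite (hnorm_sub_sym l). generalize (HN m Hm) (HN n Hn). lra.
Qed.

Record csub (N : H -> Prop) : Prop := {
  csub_zero : N (hzero H);
  csub_add : forall x y, N x -> N y -> N (hadd H x y);
  csub_scal : forall a x, N x -> N (hscal H a x);
  csub_lim : forall u l, (forall n, N (u n)) -> tends u l -> N l
}.

Lemma csub_rscal (N : H -> Prop) (r : R) (x : H) : csub N -> N x -> N (rscal r x).
Proof. intros C. apply (csub_scal N C). Qed.

Lemma csub_hI (N : H -> Prop) (x : H) : csub N -> N x -> N (hI x).
Proof. intros C. apply (csub_scal N C). Qed.

Lemma rscal_m1 (x : H) : rscal (-1) x = hopp H x.
Proof. hvec. Qed.

Lemma csub_opp (N : H -> Prop) (x : H) : csub N -> N x -> N (hopp H x).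
Proof. intros C Nx. rewrite <- rscal_m1. apply csub_rscal; assumption. Qed.

Lemma csub_sub (N : H -> Prop) (x y : H) : csub N -> N x -> N y -> N (hsub x y).
Proof. intros C Nx Ny. apply (csub_add N C); [|apply csub_opp]; assumption. Qed.

(* The minimising sequence of the distance to [D] is Cauchy by the parallelogram law. *)
Lemma csub_full (D : H -> Prop) :
  csub D -> (forall z, (forall x, D x -> rip x z = 0) -> z = hzero H) -> forall x, D x.
Proof.
intros C Orth x.
(* [completeness] yields suprema, so squared distances enter with a minus sign and [- m] is their
   infimum. *)
set (E := fun r => exists y, D y /\ r = - rip (hsub x y) (hsub x y)).
destruct (completeness E) as [m [Ub Lub]].
- exists 0. intros r [y [_ ->]]. generalize (rip_pos (hsub x y)). lra.
- exists (- rip (hsub x (hzero H)) (hsub x (hzero H))), (hzero H).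
  split; [apply csub_zero, C|reflexivity].
- assert (Up : forall y, D y -> - m <= rip (hsub x y) (hsub x y)).
  { intros y Dy. assert (- rip (hsub x y) (hsub x y) <= m) by (apply Ub; exists y; auto). lra. }
  assert (Seq : forall n : nat, exists y, D y /\
            rip (hsub x y) (hsub x y) < - m + / (INR n + 1)).
  { intros n. apply NNPP. intros Hn.
    assert (Hi : 0 < / (INR n + 1)) by (apply Rinv_0_lt_compat; generalize (pos_INR n); lra).
    assert (m <= m - / (INR n + 1)); [|lra].
    apply Lub. intros r [y [Dy ->]]. apply Rnot_lt_le. intros Hlt. apply Hn.
    exists y. split; [assumption|lra]. }
  destruct (choice (fun (n : nat) y => D y /\
            rip (hsub x y) (hsub x y) < - m + / (INR n + 1)) Seq) as [y Hy].
  assert (Par : forall p q, rip (hsub (y p) (y q)) (hsub (y p) (y q))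
             <= 2 * / (INR p + 1) + 2 * / (INR q + 1)).
  { intros p q. destruct (Hy p) as [Dp Lp]. destruct (Hy q) as [Dq Lq].
    assert (M := Up (rscal (1/2) (hadd H (y p) (y q)))
      (csub_rscal D _ _ C (csub_add D C _ _ Dp Dq))).
    revert M Lp Lq. unfold hsub. autorewrite with rip.
    rewrite (rip_sym (y q) (y p)), (rip_sym (y p) x), (rip_sym (y q) x). lra. }
  assert (Lim0 : forall eps, 0 < eps -> exists N : nat, forall n, (N <= n)%nat ->
             / (INR n + 1) < eps).
  { intros eps He. destruct (archimed_cor1 eps He) as [N [HN N0]].
    exists N. intros n Hn. eapply Rle_lt_trans; [|exact HN].
    apply Rinv_le_contravar; [apply lt_0_INR; lia|].
    apply le_INR in Hn. lra. }
  destruct (cauchy_tends y) as [l Hl].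
  { intros eps He. destruct (Lim0 (eps * eps / 4)) as [N HN]; [nra|].
    exists N. intros p q Hp Hq. apply Rsqr_incrst_0; unfold Rsqr;
      [|apply hnorm_ge0|lra].
    rewrite hnorm_sqr. generalize (Par p q) (HN p Hp) (HN q Hq). lra. }
  assert (Dl : D l) by (apply (csub_lim D C y); [intros n; apply Hy|exact Hl]).
  assert (Min : rip (hsub x l) (hsub x l) <= - m).
  { assert (Hx : tends (fun n => hsub x (y n)) (hsub x l))
      by (apply tends_add; [apply tends_const|apply tends_opp, Hl]).
    apply (is_lim_seq_le (fun n => rip (hsub x (y n)) (hsub x (y n)))
      (fun n => - m + / (INR n + 1)) (rip (hsub x l) (hsub x l)) (- m)).
    - intros n. left. apply Hy.
    - apply tends_rip; assumption.
    - replace (- m) with (- m + 0) at 1 by ring.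
      apply is_lim_seq_plus'; [apply is_lim_seq_const|].
      apply is_lim_seq_spec. intros [eps He]. destruct (Lim0 eps He) as [N HN].
      exists N. intros n Hn. simpl. rewrite Rminus_0_r, Rabs_pos_eq; [apply HN, Hn|].
      left. apply Rinv_0_lt_compat. generalize (pos_INR n). lra. }
  assert (hsub x l = hzero H); [|rewrite (hsub_eq x l); assumption].
  apply Orth. intros d Dd.
  set (t := rip d (hsub x l)).
  assert (Q : forall s, 0 <= - 2 * s * t + s * s * rip d d).
  { intros s. assert (M := Up (hadd H l (rscal s d))
      (csub_add D C _ _ Dl (csub_rscal D _ _ C Dd))).
    replace (hsub x (hadd H l (rscal s d))) with (hadd H (hsub x l) (rscal (- s) d)) in M
      by (unfold hsub; hvec).
    autorewrite with rip in M. rewrite (rip_sym (hsub x l) d) in M. fold t in M. lra. }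
  generalize (rip_pos d). intros Pd.
  (* At this [s] the quadratic is a negative multiple of [t * t], so [t = 0]; the summand 1 avoids a
     case split on [d = 0]. *)
  assert (Q1 := Q (t / (1 + rip d d))).
  apply Rmult_le_compat_r with (r := (1 + rip d d) * (1 + rip d d)) in Q1; [|nra].
  replace ((-2 * (t / (1 + rip d d)) * t + t / (1 + rip d d) * (t / (1 + rip d d)) * rip d d) *
     ((1 + rip d d) * (1 + rip d d))) with (- (t * t) * (2 + rip d d)) in Q1 by (field; lra).
  nra.
Qed.

Record linop (T : H -> H) : Prop := {
  linop_add : forall x y, T (hadd H x y) = hadd H (T x) (T y);
  linop_scal : forall a x, T (hscal H a x) = hscal H a (T x)
}.

Lemma linop_rscal (T : H -> H) (r : R) (x : H) : linop T -> T (rscal r x) = rscal r (T x).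
Proof. intros L. apply (linop_scal T L). Qed.

Lemma linop_hI (T : H -> H) (x : H) : linop T -> T (hI x) = hI (T x).
Proof. intros L. apply (linop_scal T L). Qed.

Lemma linop_opp (T : H -> H) (x : H) : linop T -> T (hopp H x) = hopp H (T x).
Proof. intros L. rewrite <- !rscal_m1. apply linop_rscal, L. Qed.

Lemma linop_sub (T : H -> H) (x y : H) : linop T -> T (hsub x y) = hsub (T x) (T y).
Proof. intros L. unfold hsub. rewrite (linop_add T L), linop_opp; auto. Qed.

End Norm.

(** * Spectral cuts of symmetric operators *)

Section LinearOperators.

Context {H : HilbertSpace}.

Lemma hscal_comm (a b : C) (x : H) : hscal H a (hscal H b x) = hscal H b (hscal H a x).
Proof. rewrite !hscal_assoc, Cmult_comm. reflexivity. Qed.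

Lemma linop_hscal (a : C) : linop (fun x : H => hscal H a x).
Proof. split; intros; [apply hscal_distr_l|apply hscal_comm]. Qed.

Lemma linop_id : linop (fun x : H => x).
Proof. split; reflexivity. Qed.

Lemma linop_comp (S T : H -> H) : linop S -> linop T -> linop (fun x => S (T x)).
Proof.
intros [Sa Ss] [Ta Ts]. split; intros; [rewrite Ta, Sa|rewrite Ts, Ss]; reflexivity.
Qed.

Lemma linop_plus (S T : H -> H) : linop S -> linop T -> linop (fun x => hadd H (S x) (T x)).
Proof.
intros [Sa Ss] [Ta Ts]. split; intros.
- rewrite Sa, Ta. hvec.
- rewrite Ts, Ss, hscal_distr_l. reflexivity.
Qed.

Lemma linop_scale (r : R) (T : H -> H) : linop T -> linop (fun x => rscal r (T x)).
Proof. apply (linop_comp _ _ (linop_hscal (RtoC r))). Qed.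

Lemma linop_minus (S T : H -> H) : linop S -> linop T -> linop (fun x => hsub (S x) (T x)).
Proof.
intros LS LT. assert (L := linop_plus _ _ LS (linop_scale (-1) _ LT)).
destruct L as [La Ls]. split; intros; unfold hsub; rewrite <- !rscal_m1; auto.
Qed.

End LinearOperators.

(** * The absolute value of a bounded symmetric operator *)

Section AbsoluteValue.

Context {H : HilbertSpace} (N : H -> Prop) (A : H -> H).
Hypothesis cN : csub N.
Hypothesis lA : linop A.
Hypothesis NA : forall x, N x -> N (A x).
Hypothesis symA : forall x y, N x -> N y -> rip (A x) y = rip x (A y).
Hypothesis bA : forall x, N x -> hnorm H (A x) <= hnorm H x.

(** Successive approximation, from 0, to the solution of [Y = (1 - A^2 + Y^2) / 2]. The iterates are
    polynomials in [A], so contractions commuting with [A] commute with the limit. *)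
Fixpoint abs_iter (n : nat) (x : H) : H :=
  match n with
  | O => hzero H
  | S n => rscal (1/2) (hadd H (hsub x (A (A x))) (abs_iter n (abs_iter n x)))
  end.

(** The same recursion for numbers, with [1 - A^2] replaced by its norm bound 1; being increasing
    and bounded by 1, it makes the operator iteration Cauchy. *)
Fixpoint abs_major (n : nat) : R :=
  match n with O => 0 | S n => (1 + abs_major n * abs_major n) / 2 end.

Lemma abs_major_bound (n : nat) : 0 <= abs_major n <= 1.
Proof. induction n as [|n IH]; simpl; nra. Qed.

Lemma abs_major_incr (n : nat) : abs_major n <= abs_major (S n).
Proof. simpl. generalize (Rle_0_sqr (abs_major n - 1)). unfold Rsqr. lra. Qed.

Lemma abs_major_cauchy : forall eps, 0 < eps -> exists n0 : nat, forall m n,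
  (n0 <= m)%nat -> (n0 <= n)%nat -> Rabs (abs_major m - abs_major n) < eps.
Proof.
destruct (ex_finite_lim_seq_incr abs_major 1) as [l L].
- apply abs_major_incr.
- apply abs_major_bound.
- intros eps He. apply is_lim_seq_spec in L.
  assert (He2 : 0 < eps / 2) by lra.
  destruct (L (mkposreal _ He2)) as [n0 Hn]. simpl in Hn. exists n0. intros m n Hm Hn'.
  generalize (Hn m Hm) (Hn n Hn'). intros E1 E2.
  apply Rabs_def2 in E1. apply Rabs_def2 in E2. apply Rabs_def1; lra.
Qed.

Lemma abs_iter_succ (n : nat) (x : H) :
  abs_iter (S n) x = rscal (1/2) (hadd H (hsub x (A (A x))) (abs_iter n (abs_iter n x))).
Proof. reflexivity. Qed.

Lemma abs_iter_linop (n : nat) : linop (abs_iter n).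
Proof.
induction n as [|n IH]; simpl.
- split; intros; [hvec|]. symmetry. apply hnorm_def.
  rewrite hnorm_hscal, hnorm_zero. ring.
- apply linop_scale, linop_plus.
  + apply linop_minus; [apply linop_id|apply linop_comp; exact lA].
  + apply linop_comp; exact IH.
Qed.

Lemma abs_iter_stable (n : nat) : forall x, N x -> N (abs_iter n x).
Proof.
induction n as [|n IH]; intros x Nx; simpl.
- apply csub_zero, cN.
- apply csub_rscal; [exact cN|]. apply csub_add; [exact cN| |auto].
  apply csub_sub; auto.
Qed.

(** Symmetry gives [|x - A^2 x|^2 = |x|^2 - 2 |A x|^2 + |A^2 x|^2], and the last term is at most
    [|A x|^2]. *)
Lemma one_sub_sqr_contraction (x : H) : N x -> hnorm H (hsub x (A (A x))) <= hnorm H x.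
Proof.
intros Nx. apply hnorm_le. unfold hsub. autorewrite with rip.
assert (B1 := rip_le _ _ (bA x Nx)). assert (B2 := rip_le _ _ (bA (A x) (NA x Nx))).
rewrite (rip_sym (A (A x)) x), <- (symA x (A x)) by auto.
generalize (rip_pos (A x)). lra.
Qed.

Lemma abs_iter_bound (n : nat) : forall x, N x ->
  hnorm H (abs_iter n x) <= abs_major n * hnorm H x.
Proof.
induction n as [|n IH]; intros x Nx; simpl.
- rewrite hnorm_zero. lra.
- rewrite hnorm_rscal, (Rabs_pos_eq (1/2)) by lra.
  assert (T := hnorm_add (hsub x (A (A x))) (abs_iter n (abs_iter n x))).
  assert (P := one_sub_sqr_contraction x Nx).
  assert (I1 := IH x Nx). assert (I2 := IH _ (abs_iter_stable n x Nx)).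
  apply (Rmult_le_compat_l (abs_major n)) in I1; [|apply abs_major_bound]. lra.
Qed.

(** [P^2 - Q^2 = P (P - Q) + (P - Q) Q] holds in any ring, so the operator and the scalar recursion
    factor alike and the bounds match term by term. *)
Lemma abs_iter_step (n : nat) : forall x, N x ->
  hnorm H (hsub (abs_iter (S n) x) (abs_iter n x))
  <= (abs_major (S n) - abs_major n) * hnorm H x.
Proof.
induction n as [|n IH]; intros x Nx.
- assert (B := abs_iter_bound 1 x Nx). simpl in B |- *.
  match goal with |- hnorm H ?u <= _ => replace u with
    (rscal (1/2) (hadd H (hsub x (A (A x))) (hzero H))) by (unfold hsub; hvec) end.
  lra.
- replace (hsub (abs_iter (S (S n)) x) (abs_iter (S n) x)) with
    (rscal (1/2) (hadd H (abs_iter (S n) (hsub (abs_iter (S n) x) (abs_iter n x)))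
       (hsub (abs_iter (S n) (abs_iter n x)) (abs_iter n (abs_iter n x))))).
  + rewrite hnorm_rscal, (Rabs_pos_eq (1/2)) by lra.
    eapply Rle_trans.
    { apply Rmult_le_compat_l; [lra|]. apply hnorm_add. }
    assert (I1 := IH x Nx).
    assert (I2 := IH _ (abs_iter_stable n x Nx)).
    assert (B1 := abs_iter_bound (S n) _
      (csub_sub N _ _ cN (abs_iter_stable (S n) x Nx) (abs_iter_stable n x Nx))).
    assert (B2 := abs_iter_bound n x Nx).
    assert (M := abs_major_incr n).
    generalize (abs_major_bound n) (abs_major_bound (S n)) (hnorm_ge0 x). intros M1 M2 X.
    replace (abs_major (S (S n)) - abs_major (S n)) with
      ((abs_major (S n) * (abs_major (S n) - abs_major n)
        + (abs_major (S n) - abs_major n) * abs_major n) / 2) by (simpl; field).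
    revert I1 I2 B1 B2. generalize (abs_major (S n)) (abs_major n) M M1 M2.
    intros p q Mi Mq Mp I1 I2 B1 B2.
    apply Rle_trans with (1/2 * (p * ((p - q) * hnorm H x) + (p - q) * (q * hnorm H x)));
      [|right; field].
    apply Rmult_le_compat_l; [lra|]. apply Rplus_le_compat.
    * eapply Rle_trans; [exact B1|]. apply Rmult_le_compat_l; [lra|exact I1].
    * eapply Rle_trans; [exact I2|]. apply Rmult_le_compat_l; [lra|exact B2].
  + rewrite (linop_sub (abs_iter (S n))) by apply abs_iter_linop.
    rewrite (abs_iter_succ (S n) x).
    set (p := abs_iter (S n) (abs_iter (S n) x)).
    set (q := abs_iter (S n) (abs_iter n x)).
    rewrite (abs_iter_succ n x).
    unfold hsub. hvec.
Qed.

Lemma abs_iter_diff (n k : nat) (x : H) : N x ->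
  hnorm H (hsub (abs_iter (n + k) x) (abs_iter n x))
  <= (abs_major (n + k) - abs_major n) * hnorm H x.
Proof.
intros Nx. induction k as [|k IH].
- rewrite Nat.add_0_r. unfold hsub. rewrite hadd_opp, hnorm_zero. lra.
- rewrite Nat.add_succ_r.
  eapply Rle_trans; [apply hnorm_sub_triangle with (y := abs_iter (n + k) x)|].
  assert (S1 := abs_iter_step (n + k) x Nx). lra.
Qed.

Lemma abs_iter_cauchy (x : H) : N x -> hcauchy (fun n => abs_iter n x).
Proof.
intros Nx eps He.
destruct (abs_major_cauchy (eps / (1 + hnorm H x))) as [n0 Hn0].
{ apply Rdiv_lt_0_compat; [lra|]. generalize (hnorm_ge0 x). lra. }
exists n0.
assert (Main : forall m n, (n0 <= m)%nat -> (m <= n)%nat ->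
          hnorm H (hsub (abs_iter n x) (abs_iter m x)) < eps).
{ intros m n Hm Hmn.
  assert (D := abs_iter_diff m (n - m) x Nx). replace (m + (n - m))%nat with n in D by lia.
  eapply Rle_lt_trans; [exact D|].
  assert (Q := Hn0 n m ltac:(lia) Hm). apply Rabs_def2 in Q. destruct Q as [Q _].
  generalize (hnorm_ge0 x). intros X.
  apply Rle_lt_trans with (eps / (1 + hnorm H x) * hnorm H x).
  - apply Rmult_le_compat_r; lra.
  - apply Rmult_lt_reg_r with (1 + hnorm H x); [lra|]. field_simplify; nra. }
intros m n Hm Hn. destruct (Nat.le_ge_cases m n).
- rewrite hnorm_sub_sym. apply Main; assumption.
- apply Main; assumption.
Qed.

(* [Y = 1 - |A|]: the fixed point of [Y = (1 - A^2 + Y^2) / 2]. *)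
Lemma abs_exists : exists Y : H -> H,
  (forall x, N x -> N (Y x)) /\
  (forall x y, N x -> N y -> Y (hadd H x y) = hadd H (Y x) (Y y)) /\
  (forall a x, N x -> Y (hscal H a x) = hscal H a (Y x)) /\
  (forall x, N x -> hnorm H (Y x) <= hnorm H x) /\
  (forall x, N x -> Y x = rscal (1/2) (hadd H (hsub x (A (A x))) (Y (Y x)))) /\
  (forall T : H -> H, linop T -> (forall x, N x -> N (T x)) ->
    (forall x, N x -> hnorm H (T x) <= hnorm H x) ->
    (forall x, N x -> T (A x) = A (T x)) -> forall x, N x -> T (Y x) = Y (T x)).
Proof.
destruct (choice (fun x y => N x -> tends (fun n => abs_iter n x) y)) as [Y HY].
{ intros x. destruct (excluded_middle_informative (N x)) as [Nx|Nx].
  - destruct (cauchy_tends _ (abs_iter_cauchy x Nx)) as [l L]. exists l. auto.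
  (* Outside [N] the value is arbitrary; every property of [Y] is claimed on [N] only. *)
  - exists x. tauto. }
assert (NY : forall x, N x -> N (Y x)).
{ intros x Nx. apply (csub_lim N cN (fun n => abs_iter n x)); [|auto].
  intros n. apply abs_iter_stable, Nx. }
assert (Ya : forall x y, N x -> N y -> Y (hadd H x y) = hadd H (Y x) (Y y)).
{ intros x y Nx Ny. apply tends_unique with (fun n => abs_iter n (hadd H x y)).
  - apply HY. apply csub_add; assumption.
  - apply tends_ext with (fun n => hadd H (abs_iter n x) (abs_iter n y)).
    + intros n. rewrite (linop_add _ (abs_iter_linop n)). reflexivity.
    + apply tends_add; auto. }
assert (Ys : forall a x, N x -> Y (hscal H a x) = hscal H a (Y x)).
{ intros a x Nx. apply tends_unique with (fun n => abs_iter n (hscal H a x)).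
  - apply HY. apply csub_scal; assumption.
  - apply tends_ext with (fun n => hscal H a (abs_iter n x)).
    + intros n. rewrite (linop_scal _ (abs_iter_linop n)). reflexivity.
    + apply tends_hscal; auto. }
assert (Yb : forall n x, N x -> hnorm H (abs_iter n x) <= hnorm H x).
{ intros n x Nx. eapply Rle_trans; [apply abs_iter_bound, Nx|].
  generalize (abs_major_bound n) (hnorm_ge0 x). nra. }
exists Y. repeat split; auto.
- intros x Nx. apply tends_norm_le with (fun n => abs_iter n x); auto.
- intros x Nx. apply tends_unique with (fun n => abs_iter (n + 1) x).
  { apply tends_incr_n with (u := fun n => abs_iter n x). auto. }
  apply tends_ext with
    (fun n => rscal (1/2) (hadd H (hsub x (A (A x))) (abs_iter n (abs_iter n x)))).
  { intros n. rewrite Nat.add_1_r. reflexivity. }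
  apply tends_hscal, tends_add; [apply tends_const|].
  apply tends_dom with (fun n => hnorm H (hsub (abs_iter n x) (Y x))
                               + hnorm H (hsub (abs_iter n (Y x)) (Y (Y x)))).
  + intros n. eapply Rle_trans; [apply hnorm_sub_triangle with (y := abs_iter n (Y x))|].
    apply Rplus_le_compat_r. rewrite <- linop_sub by apply abs_iter_linop.
    apply Yb. apply csub_sub; auto. apply abs_iter_stable, Nx.
  + replace (Finite 0) with (Finite (0 + 0)) by (f_equal; ring).
    apply is_lim_seq_plus'; apply HY; auto.
- intros T lT NT bT cT x Nx.
  assert (E : forall n x, N x -> T (abs_iter n x) = abs_iter n (T x)).
  { induction n as [|n IH]; intros z Nz; simpl.
    - replace (hzero H) with (rscal 0 (hzero H)) at 1 by hvec.
      rewrite linop_rscal by assumption. hvec.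
    - rewrite linop_rscal, (linop_add T lT), linop_sub, cT, cT by auto.
      rewrite (IH (abs_iter n z)), (IH z) by (auto; apply abs_iter_stable, Nz). reflexivity. }
  apply tends_unique with (fun n => abs_iter n (T x)); [|auto].
  apply tends_ext with (fun n => T (abs_iter n x)); [auto|].
  apply tends_dom with (fun n => hnorm H (hsub (abs_iter n x) (Y x))).
  + intros n. rewrite <- linop_sub by assumption. apply bT. apply csub_sub; auto.
    apply abs_iter_stable, Nx.
  + apply HY, Nx.
Qed.

End AbsoluteValue.

(** * Cutting down the spectrum on invariant subspaces *)

Section SpectralCut.

Context {H : HilbertSpace} (W : R -> H -> H).
Hypothesis W_linop : forall t, linop (W t).
Hypothesis W_isom : forall t x y, rip (W t x) (W t y) = rip x y.

Definition nontriv (N : H -> Prop) : Prop := exists x, N x /\ x <> hzero H.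

Record winv (N : H -> Prop) : Prop := {
  winv_csub : csub N;
  winv_stable : forall t x, N x -> N (W t x)
}.

(** The operators to be cut: they preserve every invariant closed subspace, so that a cut may be
    repeated inside the subspace left by an earlier one. *)
Record adm (A : H -> H) : Prop := {
  adm_linop : linop A;
  adm_sym : forall x y, rip (A x) y = rip x (A y);
  adm_comm : forall t x, W t (A x) = A (W t x);
  adm_stable : forall N, winv N -> forall x, N x -> N (A x)
}.

Lemma W_norm (t : R) (x : H) : hnorm H (W t x) = hnorm H x.
Proof. apply hnorm_eq, W_isom. Qed.

Lemma adm_affine (A : H -> H) (r m : R) : adm A ->
  adm (fun x => rscal r (hsub (A x) (rscal m x))).
Proof.
intros [l s c p]. split.
- apply linop_scale, linop_minus; [exact l|apply linop_scale, linop_id].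
- intros x y. unfold hsub. autorewrite with rip. rewrite s. ring.
- intros t x. rewrite linop_rscal, linop_sub, linop_rscal, c by apply W_linop. reflexivity.
- intros N [cN wN] x Nx. apply csub_rscal; [exact cN|].
  apply csub_sub; [exact cN|apply p; [split|]; assumption|apply csub_rscal; assumption].
Qed.

(* The two alternatives are the nonvanishing of the positive part [|A| + A] of [A] on [N]
   and [|A| = - A]; in the first one [N'] is the subspace where [|A| = A]. *)
Lemma spectral_cut (N : H -> Prop) (A : H -> H) : winv N -> adm A ->
  (forall x, N x -> hnorm H (A x) <= hnorm H x) ->
  (exists N', (forall x, N' x -> N x) /\ winv N' /\ nontriv N' /\
     (forall x, N' x -> hnorm H (hsub x (A x)) <= hnorm H x))
  \/ (forall x, N x -> hnorm H (hadd H x (A x)) <= hnorm H x).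
Proof.
intros [cN wN] [lA sA wA pA] bA.
assert (NA : forall x, N x -> N (A x)) by (apply pA; split; assumption).
destruct (abs_exists N A cN lA NA (fun x y _ _ => sA x y) bA)
  as [Y [NY [Ya [Ys [Yb [Ye Yc]]]]]].
assert (YA : forall x, N x -> A (Y x) = Y (A x)) by (apply Yc; auto).
assert (YW : forall t x, N x -> W t (Y x) = Y (W t x)).
{ intros t. apply Yc; auto. intros x Nx. rewrite W_norm. lra. }
assert (Yo : forall x, N x -> Y (hopp H x) = hopp H (Y x)).
{ intros x Nx. rewrite <- !rscal_m1. apply Ys, Nx. }
(* With [Y = 1 - |A|], the equation says [|A| x = A x]. *)
set (N' := fun x => N x /\ Y x = hsub x (A x)).
(* [x - Y x + A x] is [(|A| + A) x], which [|A| - A] annihilates because [|A|^2 = A^2]; [Ev] below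
   is that identity in terms of [Y]. *)
assert (In' : forall x, N x -> N' (hadd H (hsub x (Y x)) (A x))).
{ intros x Nx. assert (NYx := NY x Nx). assert (NAx := NA x Nx). split.
  - apply csub_add; auto. apply csub_sub; auto.
  - assert (E := Ye x Nx). unfold hsub.
    assert (NoYx : N (hopp H (Y x))) by (apply csub_opp; assumption).
    assert (Nd : N (hadd H x (hopp H (Y x)))) by (apply csub_add; assumption).
    rewrite (Ya _ _ Nd NAx), (Ya _ _ Nx NoYx), (Yo _ NYx), !(linop_add A lA),
      (linop_opp A _ lA), (YA _ Nx).
    set (u := Y x) in *. set (v := Y u) in *.
    assert (Ev : v = hadd H (hsub (rscal 2 u) x) (A (A x))).
    { clearbody v. clearbody u. apply hext. intros z.
      apply (f_equal (fun w => rip w z)) in E. unfold hsub in *.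
      autorewrite with rip in *. lra. }
    rewrite Ev. unfold hsub. hvec. }
destruct (classic (nontriv N')) as [nt|nt].
- left. exists N'. split; [intros x [Nx _]; exact Nx|]. split; [|split; [exact nt|]].
  + split; [split|].
    * split; [apply csub_zero, cN|].
      replace (hzero H) with (rscal 0 (hzero H)) by hvec.
      unfold rscal at 1. rewrite Ys by apply csub_zero, cN.
      fold (rscal 0 (Y (hzero H))). rewrite linop_rscal by assumption. unfold hsub. hvec.
    * intros x y [Nx Ex] [Ny Ey]. split; [apply csub_add; auto|].
      rewrite Ya, Ex, Ey, (linop_add A lA) by assumption. unfold hsub. hvec.
    * intros a x [Nx Ex]. split; [apply csub_scal; auto|].
      rewrite Ys, Ex, (linop_scal A lA) by assumption.
      apply (linop_sub (fun z => hscal H a z)), linop_hscal.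
    * intros u l Nu L.
      assert (Nl : N l) by (apply (csub_lim N cN u); [intros n; apply Nu|exact L]).
      split; [exact Nl|].
      apply tends_unique with (fun n => Y (u n)).
      -- apply tends_lip with (c := 1); [|exact L]. intros n.
         unfold hsub at 1. destruct (Nu n) as [Nun _].
         rewrite <- (Yo l Nl), <- (Ya _ _ Nun (csub_opp N l cN Nl)).
         rewrite Rmult_1_l. apply Yb. apply csub_sub; auto.
      -- apply tends_ext with (fun n => hsub (u n) (A (u n))).
         { intros n. symmetry. apply Nu. }
         apply tends_add; [exact L|]. apply tends_opp.
         apply tends_lip with (c := 1); [|exact L]. intros n.
         rewrite <- linop_sub by assumption. rewrite Rmult_1_l. apply bA.
         apply csub_sub; auto. apply Nu.
    * intros t x [Nx Ex]. split; [auto|].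
      rewrite <- YW, Ex, linop_sub, wA by auto. reflexivity.
  + intros x [Nx Ex]. rewrite <- Ex. apply Yb, Nx.
- right. intros x Nx.
  assert (E : hadd H (hsub x (Y x)) (A x) = hzero H).
  { apply NNPP. intros Hn. apply nt. eexists. split; [apply In', Nx|exact Hn]. }
  replace (hadd H x (A x)) with (hadd H (hadd H (hsub x (Y x)) (A x)) (Y x))
    by (unfold hsub; hvec).
  rewrite E, hadd_comm, hadd_zero. apply Yb, Nx.
Qed.

(* Parallelogram law; [7/8] is a rational upper bound of [sqrt 3 / 2]. *)
Lemma half_contraction (x y : H) :
  hnorm H y <= hnorm H x -> hnorm H (hsub x y) <= hnorm H x ->
  hnorm H (hsub y (rscal (1/2) x)) <= 7/8 * hnorm H x.
Proof.
intros B1 B2. apply rip_le in B1. apply rip_le in B2. apply hnorm_le_scal; [lra|].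
revert B2. unfold hsub. autorewrite with rip. rewrite (rip_sym y x).
generalize (rip_pos x). lra.
Qed.

(** Bisection: [B = (A - m) / r] is cut at 0 and the centre moves to [m + r / 2] or [m - r / 2]. The
    radius shrinks by 7/8 instead of 1/2, because [half_contraction] uses norm bounds only. *)
Lemma spectral_shrink (A : H -> H) (N : H -> Prop) : adm A -> winv N -> nontriv N ->
  (forall x, N x -> hnorm H (A x) <= hnorm H x) ->
  forall n, exists N' m, (forall x, N' x -> N x) /\ winv N' /\ nontriv N' /\
    (forall x, N' x -> hnorm H (hsub (A x) (rscal m x)) <= (7/8) ^ n * hnorm H x).
Proof.
intros aA iN tN bA. induction n as [|n [N1 [m [sub [i1 [t1 b1]]]]]].
- exists N, 0. repeat split; auto; try apply iN. intros x Nx. simpl.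
  replace (hsub (A x) (rscal 0 x)) with (A x) by (unfold hsub; hvec).
  specialize (bA x Nx). lra.
- set (r := (7/8) ^ n) in *. assert (r0 : 0 < r) by (apply pow_lt; lra).
  set (B := fun x => rscal (/ r) (hsub (A x) (rscal m x))).
  assert (aB : adm B) by (apply adm_affine, aA).
  assert (bB : forall x, N1 x -> hnorm H (B x) <= hnorm H x).
  { intros x Nx. unfold B. rewrite hnorm_rscal, Rabs_pos_eq
      by (left; apply Rinv_0_lt_compat, r0).
    apply Rmult_le_reg_l with r; [exact r0|]. rewrite <- Rmult_assoc, Rinv_r, Rmult_1_l by lra.
    apply b1, Nx. }
  assert (Est : forall e x, hnorm H (hsub (B x) (rscal e x)) <= 7/8 * hnorm H x ->
     hnorm H (hsub (A x) (rscal (m + r * e) x)) <= (7/8) ^ S n * hnorm H x).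
  { intros e x E.
    replace (hsub (A x) (rscal (m + r * e) x)) with (rscal r (hsub (B x) (rscal e x)))
      by (unfold B, hsub; hvec; lra).
    rewrite hnorm_rscal, Rabs_pos_eq by lra. simpl. fold r. nra. }
  destruct (spectral_cut N1 B i1 aB bB) as [[N' [s' [i' [t' b']]]]|b'].
  + exists N', (m + r * (1/2)). repeat split; auto; try apply i'.
    intros x Nx. apply Est, half_contraction; [apply bB|apply b']; auto.
  + exists N1, (m + r * (-1/2)). repeat split; auto; try apply i1.
    intros x Nx. apply Est.
    replace (hsub (B x) (rscal (-1/2) x))
      with (rscal (-1) (hsub (rscal (-1) (B x)) (rscal (1/2) x))) by (unfold hsub; hvec).
    rewrite rscal_m1, hnorm_opp.
    apply half_contraction.
    * rewrite rscal_m1, hnorm_opp. apply bB, Nx.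
    * replace (hsub x (rscal (-1) (B x))) with (hadd H x (B x)) by (unfold hsub; hvec).
      apply b', Nx.
Qed.

End SpectralCut.

(** * One-parameter unitary groups *)

Record unitary_group {H : HilbertSpace} (W : R -> H -> H) : Prop := {
  ug_linop : forall t, linop (W t);
  ug_isom : forall t x y, rip (W t x) (W t y) = rip x y;
  ug_zero : forall x, W 0 x = x;
  ug_add : forall s t x, W (s + t) x = W s (W t x);
  ug_cont : forall x eps, 0 < eps -> exists delta, 0 < delta /\
    forall t, Rabs t < delta -> hnorm H (hsub (W t x) x) < eps
}.

(** Models [Re <T x, y>] for a complex linear contraction [T]; [sform_hI] is what remains of
    sesquilinearity. *)
Record sform {H : HilbertSpace} (c : H -> H -> R) : Prop := {
  sform_add_l : forall x y z, c (hadd H x y) z = c x z + c y z;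
  sform_add_r : forall x y z, c x (hadd H y z) = c x y + c x z;
  sform_scal_l : forall r x y, c (rscal r x) y = r * c x y;
  sform_scal_r : forall r x y, c x (rscal r y) = r * c x y;
  sform_hI : forall x y, c (hI x) y = - c x (hI y);
  sform_bound : forall x y, Rabs (c x y) <= hnorm H x * hnorm H y
}.

Lemma half_pow_small (a eps : R) : 0 < eps -> exists m : nat, forall k, (m <= k)%nat ->
  Rabs a / 2 ^ k < eps.
Proof.
intros He.
destruct (pow_lt_1_zero (1/2)) with (y := eps / (Rabs a + 1)) as [m Hm].
- rewrite Rabs_pos_eq; lra.
- apply Rdiv_lt_0_compat; [exact He|]. generalize (Rabs_pos a). lra.
- exists m. intros k Hk. specialize (Hm k Hk). generalize (Rabs_pos a). intros Pa.
  assert (P2 : 0 < 2 ^ k) by (apply pow_lt; lra).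
  rewrite Rabs_pos_eq in Hm by (apply pow_le; lra).
  unfold Rdiv in Hm at 1. rewrite Rmult_1_l, pow_inv in Hm.
  apply Rle_lt_trans with ((Rabs a + 1) * / 2 ^ k).
  + apply Rmult_le_compat_r; [left; apply Rinv_0_lt_compat, P2|lra].
  + apply Rmult_lt_reg_l with (/ (Rabs a + 1)); [apply Rinv_0_lt_compat; lra|].
    rewrite <- Rmult_assoc, Rinv_l, Rmult_1_l by lra. unfold Rdiv in Hm. lra.
Qed.

Section OneParameter.

Context {H : HilbertSpace} (W : R -> H -> H).
Hypothesis UW : unitary_group W.

Let W_linop := ug_linop W UW.
Let W_isom := ug_isom W UW.

Lemma ug_norm (t : R) (x : H) : hnorm H (W t x) = hnorm H x.
Proof. apply W_norm, W_isom. Qed.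

Lemma ug_inv (t : R) (x : H) : W (- t) (W t x) = x.
Proof. rewrite <- (ug_add W UW), Rplus_opp_l. apply (ug_zero W UW). Qed.

Lemma ug_inv' (t : R) (x : H) : W t (W (- t) x) = x.
Proof. rewrite <- (ug_add W UW), Rplus_opp_r. apply (ug_zero W UW). Qed.

Lemma ug_comm (s t : R) (x : H) : W s (W t x) = W t (W s x).
Proof. rewrite <- !(ug_add W UW), Rplus_comm. reflexivity. Qed.

Lemma ug_adj (t : R) (x y : H) : rip (W t x) y = rip x (W (- t) y).
Proof. rewrite <- (ug_inv' t y) at 1. apply W_isom. Qed.

(** The cosine of [r] times the generator; it is symmetric because [W (- r)] is the adjoint of
    [W r]. The means below are products of such cosines at [r / 2], [r / 4], and so on. *)
Definition wcos (r : R) (x : H) : H := rscal (1/2) (hadd H (W r x) (W (- r) x)).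

(* [avg m r x] is the mean of [W t x] over [2 ^ m] equidistant [t] in [[-r, r]]. *)
Fixpoint avg (m : nat) (r : R) (x : H) : H :=
  match m with O => x | S m => wcos (r / 2) (avg m (r / 2) x) end.

Lemma wcos_linop (r : R) : linop (wcos r).
Proof. apply linop_scale, linop_plus; apply W_linop. Qed.

Lemma wcos_norm (r : R) (x : H) : hnorm H (wcos r x) <= hnorm H x.
Proof.
unfold wcos. rewrite hnorm_rscal, Rabs_pos_eq by lra.
generalize (hnorm_add (W r x) (W (- r) x)). rewrite !ug_norm. lra.
Qed.

Lemma wcos_comm (t r : R) (x : H) : W t (wcos r x) = wcos r (W t x).
Proof.
unfold wcos. rewrite (linop_rscal (W t)), (linop_add (W t)) by apply W_linop.
rewrite (ug_comm t r), (ug_comm t (- r)). reflexivity.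
Qed.

Lemma wcos_sym (r : R) (x y : H) : rip (wcos r x) y = rip x (wcos r y).
Proof.
unfold wcos. autorewrite with rip. rewrite !ug_adj, Ropp_involutive. ring.
Qed.

Lemma wcos_stable (N : H -> Prop) (r : R) (x : H) : winv W N -> N x -> N (wcos r x).
Proof.
intros [cN wN] Nx. unfold wcos. apply csub_rscal; [exact cN|].
apply (csub_add N cN); apply wN, Nx.
Qed.

Lemma avg_linop (m : nat) : forall r, linop (avg m r).
Proof.
induction m as [|m IH]; intros r; simpl; [apply linop_id|].
apply linop_comp; [apply wcos_linop|apply IH].
Qed.

Lemma avg_norm (m : nat) : forall r x, hnorm H (avg m r x) <= hnorm H x.
Proof.
induction m as [|m IH]; intros r x; simpl; [lra|].
eapply Rle_trans; [apply wcos_norm|apply IH].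
Qed.

Lemma avg_comm (m : nat) : forall t r x, W t (avg m r x) = avg m r (W t x).
Proof.
induction m as [|m IH]; intros t r x; simpl; [reflexivity|].
rewrite wcos_comm, IH. reflexivity.
Qed.

Lemma wcos_avg (m : nat) (s r : R) (x : H) : wcos s (avg m r x) = avg m r (wcos s x).
Proof.
unfold wcos. rewrite (linop_rscal (avg m r)), (linop_add (avg m r)), !avg_comm by apply avg_linop.
reflexivity.
Qed.

Lemma avg_sym (m : nat) : forall r x y, rip (avg m r x) y = rip x (avg m r y).
Proof.
induction m as [|m IH]; intros r x y; simpl; [reflexivity|].
rewrite wcos_sym, IH, wcos_avg. reflexivity.
Qed.

Lemma avg_stable (N : H -> Prop) (m : nat) : winv W N ->
  forall r x, N x -> N (avg m r x).
Proof.
intros iN. induction m as [|m IH]; intros r x Nx; simpl; [exact Nx|].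
apply wcos_stable; auto.
Qed.

(** The centre [t0] varies so that induction can split the interval into halves centred at
    [t0 - r / 2] and [t0 + r / 2]. *)
Lemma avg_near (x : H) (e : R) (m : nat) : forall r t0, 0 <= r ->
  (forall t, t0 - r <= t <= t0 + r -> hnorm H (hsub (W t x) x) <= e) ->
  hnorm H (hsub (W t0 (avg m r x)) x) <= e.
Proof.
induction m as [|m IH]; intros r t0 Hr B; simpl.
- apply B. lra.
- unfold wcos. rewrite (linop_rscal (W t0)), (linop_add (W t0)) by apply W_linop.
  rewrite <- !(ug_add W UW).
  match goal with |- hnorm H (hsub (rscal _ (hadd H ?p ?q)) _) <= _ =>
    replace (hsub (rscal (1/2) (hadd H p q)) x)
      with (rscal (1/2) (hadd H (hsub p x) (hsub q x))) by (unfold hsub; hvec);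
    assert (hnorm H (hsub p x) <= e) by (apply IH; [lra|intros t Ht; apply B; lra]);
    assert (hnorm H (hsub q x) <= e) by (apply IH; [lra|intros t Ht; apply B; lra]);
    generalize (hnorm_add (hsub p x) (hsub q x))
  end.
  rewrite hnorm_rscal, Rabs_pos_eq by lra. lra.
Qed.

Lemma avg_split (m k : nat) : forall r x,
  avg (m + k) r x = avg m r (avg k (r / 2 ^ m) x).
Proof.
induction m as [|m IH]; intros r x; simpl.
- f_equal. field.
- rewrite IH. do 3 f_equal. field. apply pow_nonzero. lra.
Qed.

(** A finer mean is a coarse mean, which contracts, of means over an interval of radius [r / 2 ^ n];
    on so short an interval [W t x] hardly differs from [x]. *)
Lemma avg_cauchy (r : R) (x : H) : 0 <= r -> hcauchy (fun n => avg n r x).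
Proof.
intros Hr eps He.
destruct (ug_cont W UW x (eps / 2)) as [d [Hd D]]; [lra|].
destruct (half_pow_small r d Hd) as [n0 Hn0]. rewrite Rabs_pos_eq in Hn0 by exact Hr.
assert (Main : forall n k, (n0 <= n)%nat ->
   hnorm H (hsub (avg (n + k) r x) (avg n r x)) < eps).
{ intros n k Hn. rewrite avg_split, <- linop_sub by apply avg_linop.
  eapply Rle_lt_trans; [apply avg_norm|].
  apply Rle_lt_trans with (eps / 2); [|lra].
  rewrite <- (ug_zero W UW (avg k (r / 2 ^ n) x)).
  specialize (Hn0 n Hn).
  apply avg_near.
  - apply Rle_div_r; [apply pow_lt; lra|lra].
  - intros t Ht. left. apply D. apply Rabs_def1; lra. }
exists n0. intros m n Hm Hn. destruct (Nat.le_ge_cases m n).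
- rewrite hnorm_sub_sym. replace n with (m + (n - m))%nat by lia. apply Main, Hm.
- replace m with (n + (m - n))%nat by lia. apply Main, Hn.
Qed.

(** Viete's product [sin r = 2^m sin (r / 2^m) cos (r / 2) ... cos (r / 2^m)] for operators. It
    bounds the increments of [W] on the range of the mean. *)
Lemma avg_telescope (m : nat) : forall r x,
  hsub (W (r / 2 ^ m) (avg m r x)) (W (- (r / 2 ^ m)) (avg m r x))
  = rscal (/ 2 ^ m) (hsub (W r x) (W (- r) x)).
Proof.
induction m as [|m IH]; intros r x.
- simpl. rewrite Rdiv_1_r, Rinv_1. unfold hsub. hvec.
- replace (r / 2 ^ S m) with (r / 2 / 2 ^ m)
    by (simpl; field; apply pow_nonzero; lra).
  simpl avg. rewrite !wcos_comm, <- linop_sub, IH by apply wcos_linop.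
  unfold wcos. rewrite !linop_rscal, (linop_sub (W (r / 2))), (linop_sub (W (- (r / 2)))),
    <- !(ug_add W UW) by apply W_linop.
  replace (r / 2 + r / 2) with r by field.
  replace (r / 2 + - (r / 2)) with 0 by field.
  replace (- (r / 2) + r / 2) with 0 by field.
  replace (- (r / 2) + - (r / 2)) with (- r) by field.
  unfold hsub. hvec. simpl. field. apply pow_nonzero. lra.
Qed.

(** The integral mean over [[- r, r]], as a strong limit of dyadic means. Averaging smooths: by the
    last clause the increments of [W] on its range are bounded linearly in the time step, which is
    where a bounded generator comes from. *)
Lemma mean_exists (r : R) : 0 <= r -> exists A : H -> H, adm W A /\
  (forall x, hnorm H (A x) <= hnorm H x) /\
  (forall x e, (forall t, Rabs t <= r -> hnorm H (hsub (W t x) x) <= e) ->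
     hnorm H (hsub (A x) x) <= e) /\
  (forall m x, hnorm H (hsub (W (2 * r / 2 ^ m) (A x)) (A x)) <= 2 / 2 ^ m * hnorm H x).
Proof.
intros Hr.
destruct (choice (fun x y => tends (fun n => avg n r x) y)) as [A HA].
{ intros x. apply cauchy_tends, avg_cauchy, Hr. }
assert (lA : linop A).
{ split; intros.
  - apply tends_unique with (fun n => avg n r (hadd H x y)); [apply HA|].
    apply tends_ext with (fun n => hadd H (avg n r x) (avg n r y)).
    + intros n. rewrite (linop_add _ (avg_linop n r)). reflexivity.
    + apply tends_add; apply HA.
  - apply tends_unique with (fun n => avg n r (hscal H a x)); [apply HA|].
    apply tends_ext with (fun n => hscal H a (avg n r x)).
    + intros n. rewrite (linop_scal _ (avg_linop n r)). reflexivity.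
    + apply tends_hscal; apply HA. }
assert (TW : forall t x, tends (fun n => W t (avg n r x)) (W t (A x))).
{ intros t x. apply tends_lip with (c := 1); [|apply HA]. intros n.
  rewrite <- linop_sub, ug_norm by apply W_linop. lra. }
exists A. split; [split|split; [|split]].
- exact lA.
- intros x y.
  assert (E : is_lim_seq (fun n => rip x (avg n r y)) (rip (A x) y)).
  { apply is_lim_seq_ext with (fun n => rip (avg n r x) y); [intros n; apply avg_sym|].
    exact (tends_rip _ _ _ _ (HA x) (tends_const y)). }
  assert (E' : is_lim_seq (fun n => rip x (avg n r y)) (rip x (A y)))
    by exact (tends_rip _ _ _ _ (tends_const x) (HA y)).
  apply is_lim_seq_unique in E. apply is_lim_seq_unique in E'.
  rewrite E in E'. injection E'. auto.
- intros t x. apply tends_unique with (fun n => avg n r (W t x)); [|apply HA].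
  apply tends_ext with (fun n => W t (avg n r x)); [intros n; apply avg_comm|apply TW].
- intros N iN x Nx. apply (csub_lim N (winv_csub W N iN) (fun n => avg n r x)); [|apply HA].
  intros n. apply avg_stable; assumption.
- intros x. apply tends_norm_le with (fun n => avg n r x); [apply HA|].
  intros n. apply avg_norm.
- intros x e He. apply tends_norm_le with (fun n => hsub (avg n r x) x).
  + apply tends_add; [apply HA|apply tends_const].
  + intros n. rewrite <- (ug_zero W UW (avg n r x)). apply avg_near; [exact Hr|].
    intros t Ht. apply He, Rabs_le. lra.
- intros m x. set (h := r / 2 ^ m).
  assert (P2 : 0 < 2 ^ m) by (apply pow_lt; lra).
  replace (2 * r / 2 ^ m) with (h + h) by (unfold h; field; lra).
  replace (hsub (W (h + h) (A x)) (A x))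
    with (W h (hsub (W h (A x)) (W (- h) (A x))))
    by (rewrite linop_sub, ug_inv', (ug_add W UW) by apply W_linop; reflexivity).
  rewrite ug_norm.
  apply tends_norm_le with
    (fun n => hsub (W h (avg (n + m) r x)) (W (- h) (avg (n + m) r x))).
  + apply tends_add; [|apply tends_opp];
      apply tends_incr_n with (u := fun n => W _ (avg n r x)); apply TW.
  + intros n. rewrite Nat.add_comm, avg_split. unfold h. rewrite avg_telescope.
    rewrite hnorm_rscal, Rabs_pos_eq by (left; apply Rinv_0_lt_compat, P2).
    set (y := avg n (r / 2 ^ m) x).
    assert (By : hnorm H y <= hnorm H x) by apply avg_norm.
    assert (T := hnorm_add (W r y) (hopp H (W (- r) y))).
    rewrite hnorm_opp, !ug_norm in T. fold (hsub (W r y) (W (- r) y)) in T.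
    unfold Rdiv. rewrite (Rmult_comm 2), Rmult_assoc.
    apply Rmult_le_compat_l; [left; apply Rinv_0_lt_compat, P2|lra].
Qed.

(* Cutting at [A >= 1/2] for the mean [A] of [W] over a short interval leaves a subspace on
   which the generator is bounded. *)
Lemma bounded_subspace (N : H -> Prop) : winv W N -> nontriv N ->
  exists N' L, (forall x, N' x -> N x) /\ winv W N' /\ nontriv N' /\
    forall m x, (L <= m)%nat -> N' x ->
      hnorm H (hsub (W (PI / 2 ^ m) x) x) <= 1/8 * hnorm H x.
Proof.
intros iN [u [Nu u0]].
assert (nu : 0 < hnorm H u).
{ destruct (hnorm_ge0 u) as [|E]; [assumption|].
  contradict u0. apply hnorm_def. auto. }
destruct (ug_cont W UW u (hnorm H u / 4)) as [d [Hd D]]; [lra|].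
destruct (half_pow_small PI d Hd) as [p Hp].
specialize (Hp p (Nat.le_refl p)). rewrite Rabs_pos_eq in Hp by (generalize PI_RGT_0; lra).
(* Half of [PI / 2 ^ p], since the mean controls steps [2 * r / 2 ^ k], which thus become
   [PI / 2 ^ (p + k)]. *)
set (r := PI / 2 ^ p / 2) in *.
assert (Pp : 0 < PI / 2 ^ p)
  by (apply Rdiv_lt_0_compat; [apply PI_RGT_0|apply pow_lt; lra]).
assert (r0 : 0 <= r) by (unfold r; lra).
destruct (mean_exists r r0) as [A [aA [bA [nA tA]]]].
(* [A - 1/2] has norm at most [3/2], hence the factor [2/3]; [B >= 0] means [A >= 1/2]. *)
set (B := fun x => rscal (2/3) (hsub (A x) (rscal (1/2) x))).
assert (aB : adm W B) by (apply adm_affine; assumption).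
destruct (spectral_cut W W_linop W_isom N B iN aB) as [[N' [s' [i' [t' b']]]]|b'].
- intros x Nx. unfold B. rewrite hnorm_rscal, Rabs_pos_eq by lra.
  generalize (hnorm_add (A x) (hopp H (rscal (1/2) x))) (bA x).
  rewrite hnorm_opp, hnorm_rscal, Rabs_pos_eq by lra.
  fold (hsub (A x) (rscal (1/2) x)). lra.
(* The 5 gives [2 / 2 ^ k <= 1/16]; inverting [A] with [Low] costs a factor 2, which leaves
   [1/8]. *)
- exists N', (p + 5)%nat. repeat split; auto; try apply i'.
  assert (Low : forall x, N' x -> hnorm H x <= 2 * hnorm H (A x)).
  { intros x Nx. assert (E := rip_le _ _ (b' x Nx)). unfold B, hsub in E.
    autorewrite with rip in E. rewrite (rip_sym x (A x)) in E.
    assert (E2 := rip_pos (rscal (2/3) (hsub (A x) (rscal (1/2) x)))).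
    unfold hsub in E2. autorewrite with rip in E2. rewrite (rip_sym x (A x)) in E2.
    assert (E3 : 1/2 * rip x x <= rip (A x) x) by lra.
    generalize (cauchy_schwarz (A x) x) (Rle_abs (rip (A x) x)) (hnorm_sqr x).
    generalize (hnorm_ge0 x) (hnorm_ge0 (A x)). intros. nra. }
  intros m x Hm Nx.
  replace m with (p + (m - p))%nat by lia. set (k := (m - p)%nat).
  replace (PI / 2 ^ (p + k)) with (2 * r / 2 ^ k)
    by (unfold r; rewrite pow_add; field; split; apply pow_nonzero; lra).
  set (h := 2 * r / 2 ^ k).
  eapply Rle_trans.
  { apply Low. apply csub_sub; [apply i'|apply (winv_stable W N' i'), Nx|exact Nx]. }
  rewrite linop_sub, <- (adm_comm W A aA) by apply aA.
  assert (T := tA k x). fold h in T.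
  assert (K : 32 <= 2 ^ k).
  { replace 32 with (2 ^ 5) by ring. apply Rle_pow; [lra|unfold k; lia]. }
  assert (2 / 2 ^ k <= 1 / 16) by (apply Rle_div_l; lra).
  generalize (hnorm_ge0 x). intros. nra.
(* Here [A <= 1/2] on [N], although [A u] is within [|u| / 4] of [u]. *)
- exfalso.
  assert (E := rip_le _ _ (b' u Nu)). unfold B, hsub in E.
  autorewrite with rip in E. rewrite (rip_sym u (A u)) in E.
  assert (E2 := rip_pos (rscal (2/3) (hsub (A u) (rscal (1/2) u)))).
  unfold hsub in E2. autorewrite with rip in E2. rewrite (rip_sym u (A u)) in E2.
  assert (E3 : rip (A u) u <= 1/2 * rip u u) by lra.
  assert (F : hnorm H (hsub (A u) u) <= hnorm H u / 4).
  { apply nA. intros t Ht. left. apply D. unfold r in Ht. lra. }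
  assert (G := cauchy_schwarz (hsub (A u) u) u).
  assert (G' := Rle_abs (- rip (hsub (A u) u) u)). rewrite Rabs_Ropp in G'.
  unfold hsub in G' at 1. autorewrite with rip in G'.
  assert (S := hnorm_sqr u). nra.
Qed.

(* [e = c(T ., T .) - c] has values on the orbit of [T] that sum up to zero, while they
   differ from each other by less than their size because [T] is close to a scalar. *)
Lemma form_root_invariant (N : H -> Prop) (c : H -> H -> R) (s mu nu eps : R) (n : nat) :
  winv W N -> sform c -> (0 < n)%nat -> 0 <= eps -> 4 * INR n * eps <= 1 ->
  (forall x, N x ->
    hnorm H (hsub (W s x) (hadd H (rscal mu x) (rscal nu (hI x)))) <= eps * hnorm H x) ->
  (forall x, N x ->
    hnorm H (hsub (W (- s) x) (hadd H (rscal mu x) (rscal (- nu) (hI x))))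
      <= eps * hnorm H x) ->
  (forall x y, N x -> N y -> c (W (INR n * s) x) (W (INR n * s) y) = c x y) ->
  forall x y, N x -> N y -> c (W s x) (W s y) = c x y.
Proof.
intros [cN wN] fc n0 e0 ne near near' per.
set (e := fun x y => c (W s x) (W s y) - c x y).
assert (eal : forall x y z, e (hadd H x y) z = e x z + e y z).
{ intros. unfold e. rewrite (linop_add _ (W_linop s)), !(sform_add_l c fc). ring. }
assert (ear : forall x y z, e x (hadd H y z) = e x y + e x z).
{ intros. unfold e. rewrite (linop_add _ (W_linop s)), !(sform_add_r c fc). ring. }
assert (esl : forall r x y, e (rscal r x) y = r * e x y).
{ intros. unfold e. rewrite (linop_rscal _ _ _ (W_linop s)), !(sform_scal_l c fc). ring. }
assert (esr : forall r x y, e x (rscal r y) = r * e x y).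
{ intros. unfold e. rewrite (linop_rscal _ _ _ (W_linop s)), !(sform_scal_r c fc). ring. }
assert (eI : forall x y, e (hI x) y = - e x (hI y)).
{ intros. unfold e. rewrite !(linop_hI _ _ (W_linop s)), !(sform_hI c fc). ring. }
(* Any bound for [e] on all of [N] improves itself by the factor 1/2, so [e] vanishes there. *)
assert (Main : forall k x y, N x -> N y ->
          Rabs (e x y) <= 2 * (1/2) ^ k * (hnorm H x * hnorm H y)).
{ induction k as [|k IH].
  - intros x y _ _. unfold e.
    assert (B1 := sform_bound c fc (W s x) (W s y)). rewrite !ug_norm in B1.
    assert (B2 := sform_bound c fc x y).
    eapply Rle_trans; [apply Rabs_triang|]. rewrite Rabs_Ropp. simpl. lra.
  - set (K := 2 * (1/2) ^ k) in *.
    assert (K0 : 0 <= K) by (unfold K; generalize (pow_le (1/2) k); lra).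
    assert (Step : forall x y, N x -> N y ->
       Rabs (e (W s x) (W s y) - e x y) <= 2 * eps * K * (hnorm H x * hnorm H y)).
    { intros x y Nx Ny. set (y' := W s y).
      set (p := hsub (W s x) (hadd H (rscal mu x) (rscal nu (hI x)))).
      set (q := hsub (W (- s) y') (hadd H (rscal mu y') (rscal (- nu) (hI y')))).
      assert (Np : N p).
      { apply csub_sub; auto. apply (csub_add N cN); apply csub_rscal; auto.
        apply csub_hI; auto. }
      assert (Nq : N q).
      { apply csub_sub; auto; unfold y'; auto.
        apply (csub_add N cN); apply csub_rscal; auto. apply csub_hI; auto. }
      assert (Ex : W s x = hadd H p (hadd H (rscal mu x) (rscal nu (hI x))))
        by (unfold p, hsub; hvec).
      assert (Ey : y = hadd H q (hadd H (rscal mu y') (rscal (- nu) (hI y')))).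
      { rewrite <- (ug_inv s y) at 1. fold y'. unfold q, hsub. hvec. }
      (* With [lambda = mu + i nu], [W s x = p + lambda x] and [y = q + conj lambda y'];
         sesquilinearity cancels the two scalar terms, and only the small errors [p] and [q]
         remain. *)
      replace (e (W s x) y' - e x y) with (e p y' - e x q)
        by (rewrite Ex, Ey at 1; rewrite !eal, !ear, !esl, !esr, eI; ring).
      assert (By : hnorm H y' = hnorm H y) by apply ug_norm.
      assert (B1 := IH p y' Np (wN s y Ny)). rewrite By in B1.
      assert (B2 := IH x q Nx Nq).
      assert (Bp := near x Nx). fold p in Bp.
      assert (Bq := near' y' (wN s y Ny)). fold q in Bq. rewrite By in Bq.
      eapply Rle_trans; [apply Rabs_triang|]. rewrite Rabs_Ropp.
      replace (2 * eps * K * (hnorm H x * hnorm H y)) with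
        (K * (eps * hnorm H x * hnorm H y) + K * (hnorm H x * (eps * hnorm H y))) by ring.
      generalize (hnorm_ge0 x) (hnorm_ge0 y). intros X Y.
      apply Rplus_le_compat.
      - eapply Rle_trans; [exact B1|]. apply Rmult_le_compat_l; [exact K0|].
        apply Rmult_le_compat_r; assumption.
      - eapply Rle_trans; [exact B2|]. apply Rmult_le_compat_l; [exact K0|].
        apply Rmult_le_compat_l; assumption. }
    intros x y Nx Ny. set (Z := hnorm H x * hnorm H y).
    assert (Z0 : 0 <= Z) by (apply Rmult_le_pos; apply hnorm_ge0).
    assert (Orb : forall j : nat,
       Rabs (e (W (INR j * s) x) (W (INR j * s) y) - e x y) <= INR j * (2 * eps * K * Z)).
    { induction j as [|j IHj].
      - simpl. rewrite !Rmult_0_l, !(ug_zero W UW), Rminus_diag, Rabs_R0. lra.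
      - replace (INR (S j) * s) with (s + INR j * s) by (rewrite S_INR; ring).
        rewrite !(ug_add W UW).
        assert (St := Step _ _ (wN (INR j * s) x Nx) (wN (INR j * s) y Ny)).
        rewrite !ug_norm in St. fold Z in St.
        set (e1 := e (W s (W (INR j * s) x)) (W s (W (INR j * s) y))) in *.
        set (e2 := e (W (INR j * s) x) (W (INR j * s) y)) in *.
        replace (e1 - e x y) with ((e1 - e2) + (e2 - e x y)) by ring.
        eapply Rle_trans; [apply Rabs_triang|]. rewrite S_INR. lra. }
    assert (Sum : forall j : nat, (j <= n)%nat ->
       Rabs (c (W (INR j * s) x) (W (INR j * s) y) - c x y - INR j * e x y)
         <= INR j * (INR n * (2 * eps * K * Z))).
    { induction j as [|j IHj]; intros Hj.
      - simpl. rewrite !Rmult_0_l, !(ug_zero W UW).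
        replace (c x y - c x y - 0) with 0 by ring. rewrite Rabs_R0. lra.
      - replace (INR (S j) * s) with (s + INR j * s) by (rewrite S_INR; ring).
        rewrite !(ug_add W UW). specialize (IHj ltac:(lia)). assert (O := Orb j).
        unfold e in O at 1.
        set (c1 := c (W s (W (INR j * s) x)) (W s (W (INR j * s) y))) in *.
        set (c2 := c (W (INR j * s) x) (W (INR j * s) y)) in *.
        replace (c1 - c x y - INR (S j) * e x y)
          with ((c1 - c2 - e x y) + (c2 - c x y - INR j * e x y)) by (rewrite S_INR; ring).
        eapply Rle_trans; [apply Rabs_triang|].
        assert (Jn : INR j <= INR n) by (apply le_INR; lia).
        assert (0 <= 2 * eps * K * Z) 
          by (apply Rmult_le_pos; [apply Rmult_le_pos; [lra|exact K0]|exact Z0]).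
        assert (INR j * (2 * eps * K * Z) <= INR n * (2 * eps * K * Z))
          by (apply Rmult_le_compat_r; assumption).
        rewrite S_INR. lra. }
    (* For [j = n] periodicity kills the telescoped sum, so [n |e x y|] is at most the accumulated
       variation; [4 n eps <= 1] turns this into the factor 1/2. *)
    assert (Q := Sum n (Nat.le_refl n)). rewrite (per x y Nx Ny), Rminus_diag in Q.
    rewrite Rminus_0_l, Rabs_Ropp, Rabs_mult, (Rabs_pos_eq (INR n)) in Q by apply pos_INR.
    apply Rmult_le_reg_l in Q; [|apply lt_0_INR; exact n0].
    eapply Rle_trans; [exact Q|]. change (2 * (1/2) ^ S k) with (2 * (1/2 * (1/2) ^ k)).
    replace (2 * (1/2 * (1/2) ^ k)) with (1/2 * K) by (unfold K; ring).
    assert (0 <= K * Z) by (apply Rmult_le_pos; assumption).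
    replace (INR n * (2 * eps * K * Z)) with (1/2 * (4 * INR n * eps) * (K * Z)) by field.
    nra. }
intros x y Nx Ny. apply Rminus_diag_uniq. fold (e x y).
apply NNPP. intros ne0. assert (P := Rabs_pos_lt _ ne0).
destruct (half_pow_small (2 * (hnorm H x * hnorm H y)) _ P) as [k Hk].
specialize (Hk k (Nat.le_refl k)). specialize (Main k x y Nx Ny).
rewrite (Rabs_pos_eq (2 * _)) in Hk
  by (generalize (Rmult_le_pos _ _ (hnorm_ge0 x) (hnorm_ge0 y)); lra).
unfold Rdiv in Main at 1. rewrite Rmult_1_l, pow_inv in Main. unfold Rdiv in Hk. lra.
Qed.

Lemma wcos_adm (s : R) : adm W (wcos s).
Proof.
split.
- apply wcos_linop.
- apply wcos_sym.
- intros. apply wcos_comm.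
- intros. apply wcos_stable; assumption.
Qed.

(** The sine of [r] times the generator: [-1/2] and [hI] together divide by [2 i], so that
    [W r = wcos r + i wsin r]. *)
Definition wsin (r : R) (x : H) : H := rscal (-1/2) (hI (hsub (W r x) (W (- r) x))).

Lemma wsin_adm (s : R) : adm W (wsin s).
Proof.
unfold wsin. split.
- apply linop_scale, (linop_comp _ _ (linop_hscal Ci)), linop_minus; apply W_linop.
- intros x y. unfold hsub. autorewrite with rip.
  rewrite !ug_adj, Ropp_involutive, !(linop_hI _ _ (W_linop _)).
  rewrite (rip_sym x (hI (hadd _ _ _))). autorewrite with rip.
  rewrite !(rip_sym (W _ y)), !rip_hI_l. ring.
- intros t x.
  rewrite (linop_rscal (W t)), (linop_hI (W t)), (linop_sub (W t)), (ug_comm t s), (ug_comm t (- s))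
    by apply W_linop. reflexivity.
- intros N [cN wN] x Nx. apply csub_rscal; [exact cN|]. apply csub_hI; [exact cN|].
  apply csub_sub; auto.
Qed.

Lemma wsin_norm (s : R) (x : H) : hnorm H (wsin s x) <= hnorm H x.
Proof.
unfold wsin. rewrite hnorm_rscal, hnorm_hI, Rabs_left by lra.
generalize (hnorm_add (W s x) (hopp H (W (- s) x))). fold (hsub (W s x) (W (- s) x)).
rewrite hnorm_opp, !ug_norm. lra.
Qed.

(** [wcos s] and [wsin s] are shrunk one after the other, the second inside the subspace found for
    the first, each to accuracy [eps / 2]; [W (- s)] uses the same two numbers because it is
    [wcos s - i wsin s]. *)
Lemma almost_scalar_subspace (N : H -> Prop) (s eps : R) :
  winv W N -> nontriv N -> 0 < eps ->
  exists N' mu nu, (forall x, N' x -> N x) /\ winv W N' /\ nontriv N' /\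
  (forall x, N' x ->
    hnorm H (hsub (W s x) (hadd H (rscal mu x) (rscal nu (hI x)))) <= eps * hnorm H x) /\
  (forall x, N' x ->
    hnorm H (hsub (W (- s) x) (hadd H (rscal mu x) (rscal (- nu) (hI x))))
      <= eps * hnorm H x).
Proof.
intros iN tN He.
destruct (pow_lt_1_zero (7/8)) with (y := eps / 2) as [k Hk];
  [rewrite Rabs_pos_eq; lra|lra|].
specialize (Hk k (Nat.le_refl k)). rewrite Rabs_pos_eq in Hk by (apply pow_le; lra).
destruct (spectral_shrink W W_linop W_isom (wcos s) N (wcos_adm s) iN tN
  (fun x _ => wcos_norm s x) k) as [N1 [mu [s1 [i1 [t1 b1]]]]].
destruct (spectral_shrink W W_linop W_isom (wsin s) N1 (wsin_adm s) i1 t1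
  (fun x _ => wsin_norm s x) k) as [N2 [nu [s2 [i2 [t2 b2]]]]].
exists N2, mu, nu. split; [auto|]. split; [exact i2|]. split; [exact t2|].
assert (Est : forall x y z, N2 x ->
  y = hadd H (hsub (wcos s x) (rscal mu x)) z ->
  hnorm H z = hnorm H (hsub (wsin s x) (rscal nu x)) -> hnorm H y <= eps * hnorm H x).
{ intros x y z Nx -> Ez. assert (B1 := b1 x (s2 x Nx)). assert (B2 := b2 x Nx).
  eapply Rle_trans; [apply hnorm_add|]. rewrite Ez.
  generalize (hnorm_ge0 x). intros. nra. }
split; intros x Nx.
- apply Est with (hI (hsub (wsin s x) (rscal nu x))); [exact Nx| |apply hnorm_hI].
  unfold wcos, wsin, hsub. apply hext. intros z. autorewrite with rip.
  rewrite !(hI_hI z). autorewrite with rip. field.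
- apply Est with (hopp H (hI (hsub (wsin s x) (rscal nu x)))); [exact Nx| |].
  + unfold wcos, wsin, hsub. apply hext. intros z. autorewrite with rip.
    rewrite !(hI_hI z). autorewrite with rip. field.
  + rewrite hnorm_opp. apply hnorm_hI.
Qed.

Lemma form_multiple_invariant (N : H -> Prop) (c : H -> H -> R) (s : R) : winv W N ->
  (forall x y, N x -> N y -> c (W s x) (W s y) = c x y) ->
  forall (j : nat) x y, N x -> N y -> c (W (INR j * s) x) (W (INR j * s) y) = c x y.
Proof.
intros [cN wN] E. induction j as [|j IH]; intros x y Nx Ny.
- simpl. rewrite Rmult_0_l, !(ug_zero W UW). reflexivity.
- replace (INR (S j) * s) with (s + INR j * s) by (rewrite S_INR; ring).
  rewrite !(ug_add W UW), E, IH by auto. reflexivity.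
Qed.

(** Multiples of [PI / 2 ^ k] approximate every [t >= 0] from below, and strong continuity with
    [sform_bound] absorbs the remainder [tau]. *)
Lemma form_dense_invariant (N : H -> Prop) (c : H -> H -> R) (L : nat) :
  winv W N -> sform c ->
  (forall m x y, (L <= m)%nat -> N x -> N y ->
     c (W (PI / 2 ^ m) x) (W (PI / 2 ^ m) y) = c x y) ->
  forall t x y, N x -> N y -> c (W t x) (W t y) = c x y.
Proof.
intros iN fc inv. assert (wN := winv_stable W N iN).
assert (Pos : forall t x y, 0 <= t -> N x -> N y -> c (W t x) (W t y) = c x y).
{ intros t x y Ht Nx Ny. apply Rminus_diag_uniq, NNPP. intros ne0.
  assert (P := Rabs_pos_lt _ ne0).
  set (g := Rabs (c (W t x) (W t y) - c x y)) in *.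
  set (M := hnorm H x + hnorm H y + 1).
  assert (M1 : 0 < M) by (unfold M; generalize (hnorm_ge0 x) (hnorm_ge0 y); lra).
  assert (G : 0 < g / M) by (apply Rdiv_lt_0_compat; assumption).
  destruct (ug_cont W UW x _ G) as [d1 [Hd1 D1]].
  destruct (ug_cont W UW y _ G) as [d2 [Hd2 D2]].
  destruct (half_pow_small PI (Rmin d1 d2)) as [m Hm]; [apply Rmin_pos; assumption|].
  set (k := (m + L)%nat). specialize (Hm k ltac:(lia)).
  rewrite Rabs_pos_eq in Hm by (generalize PI_RGT_0; lra).
  set (s := PI / 2 ^ k) in *.
  assert (s0 : 0 < s) by (apply Rdiv_lt_0_compat; [apply PI_RGT_0|apply pow_lt; lra]).
  destruct (nfloor_ex (t / s)) as [j [J1 J2]]; [apply Rle_div_r; lra|].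
  apply Rle_div_r in J1; [|exact s0]. apply Rlt_div_l in J2; [|exact s0].
  set (tau := t - INR j * s).
  assert (Tau : Rabs tau < Rmin d1 d2) by (rewrite Rabs_pos_eq; unfold tau; lra).
  assert (E : c (W t x) (W t y) = c (W tau x) (W tau y)).
  { replace t with (INR j * s + tau) by (unfold tau; ring). rewrite !(ug_add W UW).
    apply (form_multiple_invariant N); auto. intros. apply inv; auto. unfold k; lia. }
  assert (g < g); [|lra]. unfold g at 1. rewrite E.
  replace (c (W tau x) (W tau y) - c x y)
    with (c (hsub (W tau x) x) (W tau y) + c x (hsub (W tau y) y)).
  2:{ unfold hsub. rewrite <- !rscal_m1, (sform_add_l c fc), (sform_add_r c fc),
        (sform_scal_l c fc), (sform_scal_r c fc). ring. }
  assert (B1 := sform_bound c fc (hsub (W tau x) x) (W tau y)).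
  assert (B2 := sform_bound c fc x (hsub (W tau y) y)).
  rewrite ug_norm in B1.
  assert (C1 := D1 tau ltac:(eapply Rlt_le_trans; [exact Tau|apply Rmin_l])).
  assert (C2 := D2 tau ltac:(eapply Rlt_le_trans; [exact Tau|apply Rmin_r])).
  eapply Rle_lt_trans; [apply Rabs_triang|].
  apply Rle_lt_trans with (g / M * (hnorm H x + hnorm H y)).
  - generalize (hnorm_ge0 x) (hnorm_ge0 y). intros. nra.
  - apply Rlt_le_trans with (g / M * M); [|right; field; lra].
    apply Rmult_lt_compat_l; [exact G|unfold M; lra]. }
intros t x y Nx Ny. destruct (Rle_dec 0 t) as [Ht|Ht]; [auto|].
rewrite <- (ug_inv' t x) at 2. rewrite <- (ug_inv' t y) at 2.
rewrite <- (Pos (- t) (W t x) (W t y)) by (auto; lra).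
rewrite !ug_inv, !ug_inv'. reflexivity.
Qed.

(** [N'] is chosen before [c], since one subspace has to serve all diagonal elements [a]. The
    passage from [PI] to [PI / 2 ^ L] is a single root of order [n = 2 ^ L] and needs an almost
    scalar [W]; every further halving uses that [W] is close to 1. *)
Lemma rigid_subspace (N : H -> Prop) : winv W N -> nontriv N ->
  exists N', (forall x, N' x -> N x) /\ winv W N' /\ nontriv N' /\
  forall c, sform c -> (forall x y, c (W PI x) (W PI y) = c x y) ->
  forall t x y, N' x -> N' y -> c (W t x) (W t y) = c x y.
Proof.
intros iN tN.
destruct (bounded_subspace N iN tN) as [N1 [L [s1 [i1 [t1 b1]]]]].
set (n := (2 ^ L)%nat).
assert (n0 : (0 < n)%nat) by (apply Nat.neq_0_lt_0, Nat.pow_nonzero; lia).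
assert (n1 : 0 < INR n) by (apply lt_0_INR; exact n0).
assert (e0 : 0 < / (4 * INR n)) by (apply Rinv_0_lt_compat; lra).
destruct (almost_scalar_subspace N1 (PI / 2 ^ L) (/ (4 * INR n)) i1 t1 e0)
  as [N2 [mu [nu [s2 [i2 [t2 [b2 b2']]]]]]].
exists N2. split; [auto|]. split; [exact i2|]. split; [exact t2|].
intros c fc per. apply form_dense_invariant with L; [exact i2|exact fc|].
assert (Ind : forall k x y, N2 x -> N2 y ->
  c (W (PI / 2 ^ (L + k)) x) (W (PI / 2 ^ (L + k)) y) = c x y).
{ induction k as [|k IH].
  - rewrite Nat.add_0_r.
    apply form_root_invariant with mu nu (/ (4 * INR n)) n; auto; try lra.
    + right. field. lra.
    + intros x y _ _. replace (INR n * (PI / 2 ^ L)) with PI; [apply per|].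
      unfold n. rewrite pow_INR. change (INR 2) with 2. field. apply pow_nonzero. lra.
  - set (s := PI / 2 ^ (L + S k)).
    assert (Near : forall x, N2 x -> hnorm H (hsub (W s x) x) <= 1/8 * hnorm H x).
    { intros x Nx. apply b1; [lia|auto]. }
    (* The constant [1/8] of [bounded_subspace] just fits: [4 * 2 * (1/8) = 1]. *)
    apply form_root_invariant with 1 0 (1/8) 2%nat; auto; try lra; try lia.
    + simpl. lra.
    + intros x Nx. replace (hadd H (rscal 1 x) (rscal 0 (hI x))) with x by hvec. auto.
    + intros x Nx. replace (hadd H (rscal 1 x) (rscal (- 0) (hI x))) with x by hvec.
      rewrite <- (ug_norm s), linop_sub, ug_inv', hnorm_sub_sym by apply W_linop. auto.
    + replace (INR 2 * s) with (PI / 2 ^ (L + k)); [exact IH|].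
      unfold s. rewrite Nat.add_succ_r. simpl. field. apply pow_nonzero. lra. }
intros m x y Hm. replace m with (L + (m - L))%nat by lia. apply Ind.
Qed.

End OneParameter.

(** * The covering group *)

Definition is_arg (t : R) (z : C) : Prop :=
  Re z = Cmod z * cos t /\ Im z = Cmod z * sin t.

Lemma Cmod_sqr (z : C) : Cmod z * Cmod z = Re z * Re z + Im z * Im z.
Proof.
unfold Cmod. rewrite sqrt_sqrt; [unfold Re, Im; ring|].
generalize (pow2_ge_0 (fst z)) (pow2_ge_0 (snd z)). lra.
Qed.

Lemma is_arg_mul (s t : R) (z w : C) :
  is_arg s z -> is_arg t w -> is_arg (s + t) (Cmult z w).
Proof.
intros [Rz Iz] [Rw Iw]. unfold is_arg. rewrite Cmod_mult, cos_plus, sin_plus.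
change (Re (Cmult z w)) with (Re z * Re w - Im z * Im w).
change (Im (Cmult z w)) with (Re z * Im w + Im z * Re w).
rewrite Rz, Iz, Rw, Iw. split; ring.
Qed.

(** [u] is the tangent of half the argument; the hypothesis keeps its denominator positive, and the
    double angle formulas recover cosine and sine. *)
Lemma Arg_correct (z : C) : Im z <> 0 \/ 0 < Re z -> is_arg (Arg z) z.
Proof.
intros Hz. unfold is_arg, Arg.
assert (M := Cmod_sqr z). assert (M0 := Cmod_ge_0 z).
set (m := Cmod z) in *. set (x := Re z) in *. set (y := Im z) in *.
assert (P : 0 < m + x).
{ destruct Hz as [Hy|Hx]; [|lra]. assert (0 < y * y) by nra. nra. }
set (u := y / (m + x)).
assert (Q : 0 < 1 + u²) by (unfold Rsqr; nra).
assert (S0 : sqrt (1 + u²) <> 0) by (apply Rgt_not_eq, sqrt_lt_R0, Q).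
assert (SS : sqrt (1 + u²) * sqrt (1 + u²) = 1 + u²) by (apply sqrt_sqrt; lra).
assert (U : u * (m + x) = y) by (unfold u; field; lra).
assert (Y2 : y * y = m * m - x * x) by lra.
clearbody m x y u.
assert (E1 : m * (1 - u * u) = x * (1 + u * u)).
{ apply Rmult_eq_reg_r with ((m + x) * (m + x)); [|nra].
  transitivity (m * ((m + x) * (m + x) - y * y)); [rewrite <- U; ring|].
  transitivity (x * ((m + x) * (m + x) + y * y)); [rewrite Y2|rewrite <- U]; ring. }
assert (E2 : m * (2 * u) = y * (1 + u * u)).
{ apply Rmult_eq_reg_r with ((m + x) * (m + x)); [|nra].
  transitivity (2 * m * (m + x) * y); [rewrite <- U; ring|].
  transitivity (y * ((m + x) * (m + x) + y * y)); [rewrite Y2|rewrite <- U]; ring. }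
rewrite cos_2a, sin_2a, cos_atan, sin_atan.
split; apply Rmult_eq_reg_r with (sqrt (1 + u²) * sqrt (1 + u²));
  try (rewrite SS; lra).
- transitivity (m * (1 - u * u)); [rewrite SS; unfold Rsqr; lra|field; exact S0].
- transitivity (m * (2 * u)); [rewrite SS; unfold Rsqr; lra|field; exact S0].
Qed.

Lemma polar_exists (x y : R) : exists t,
  x = sqrt (x ^ 2 + y ^ 2) * cos t /\ y = sqrt (x ^ 2 + y ^ 2) * sin t.
Proof.
destruct (classic (y <> 0 \/ 0 < x)) as [Hz|Hz].
- exists (Arg (x, y)). apply (Arg_correct (x, y)). exact Hz.
- exists PI. assert (y = 0) by (apply NNPP; tauto). subst y.
  assert (x <= 0) by (apply Rnot_lt_le; tauto).
  replace (x ^ 2 + 0 ^ 2) with ((- x)²) by (unfold Rsqr; ring).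
  rewrite sqrt_Rsqr, cos_PI, sin_PI by lra. split; ring.
Qed.

Lemma Arg_pos (r : R) : 0 < r -> Arg (RtoC r) = 0.
Proof.
intros Hr. unfold Arg. simpl. unfold Rdiv. rewrite Rmult_0_l, atan_0. ring.
Qed.

Lemma Arg_conj (z : C) : Arg (Cconj z) = - Arg z.
Proof.
unfold Arg. rewrite Cmod_conj. change (Im (Cconj z)) with (- Im z).
change (Re (Cconj z)) with (Re z). unfold Rdiv.
rewrite Ropp_mult_distr_l_reverse, atan_opp. ring.
Qed.

(** [j(k_t, i) = exp (i t)], so [t] is itself the angle of the lift and runs through the whole line;
    a positive diagonal element has [j > 0], hence angle 0. *)
Definition kt (t : R) : SLt := mkSLt (cos t) (- sin t) (sin t) (cos t) t.
Definition at_ (p : R) : SLt := mkSLt p 0 0 (/ p) 0.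

Lemma jfac_I (g : SLt) : jfac g Ci = (sd g, sc g).
Proof. apply injective_projections; simpl; ring. Qed.

Lemma inSLt_alt (g : SLt) :
  inSLt g <-> sa g * sd g - sb g * sc g = 1 /\ is_arg (sth g) (jfac g Ci).
Proof.
rewrite jfac_I. unfold inSLt, is_arg, Cmod. unfold Re, Im.
simpl fst; simpl snd.
rewrite (Rplus_comm (sd g ^ 2)). reflexivity.
Qed.

Lemma kt_in (t : R) : inSLt (kt t).
Proof.
assert (E := sin2_cos2 t). unfold Rsqr in E.
unfold inSLt, kt; simpl. replace (_ + _) with 1 by lra. rewrite sqrt_1. repeat split; lra.
Qed.

Lemma at_in (p : R) : 0 < p -> inSLt (at_ p).
Proof.
intros Hp. assert (0 < / p) by (apply Rinv_0_lt_compat, Hp).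
unfold inSLt, at_. cbn [sa sb sc sd sth].
replace (0 ^ 2 + (/ p) ^ 2) with ((/ p)²) by (unfold Rsqr; ring).
rewrite sqrt_Rsqr, cos_0, sin_0 by lra. repeat split; try ring. field. lra.
Qed.

Lemma tauG_in (g : SLt) : inSLt g -> inSLt (tauG g).
Proof.
unfold inSLt, tauG; cbn [sa sb sc sd sth]. rewrite cos_neg, sin_neg.
replace ((- sc g) ^ 2) with (sc g ^ 2) by ring.
intros [E [Ec Es]]. repeat split; [lra|exact Ec|lra].
Qed.

Lemma tauG_tauG (g : SLt) : tauG (tauG g) = g.
Proof. destruct g. unfold tauG; cbn. rewrite !Ropp_involutive. reflexivity. Qed.

Lemma tauG_kt (t : R) : tauG (kt t) = kt (- t).
Proof. unfold tauG, kt; cbn. rewrite cos_neg, sin_neg. reflexivity. Qed.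

Lemma tauG_at (p : R) : tauG (at_ p) = at_ p.
Proof. unfold tauG, at_; cbn. rewrite Ropp_0. reflexivity. Qed.

Lemma jfac_nonzero (g : SLt) : inSLt g -> jfac g Ci <> RtoC 0.
Proof.
intros [D _] E. rewrite jfac_I in E. injection E. intros Ec Ed.
rewrite Ec, Ed in D. lra.
Qed.

Lemma moeb_I (g : SLt) : inSLt g ->
  moeb g Ci = ((sb g * sd g + sa g * sc g) / (sd g * sd g + sc g * sc g),
               / (sd g * sd g + sc g * sc g)).
Proof.
intros Hg. assert (D := proj1 Hg). assert (Z := jfac_nonzero g Hg).
assert (P : sd g * sd g + sc g * sc g <> 0).
{ intros E. apply Z. rewrite jfac_I. assert (sd g = 0) by nra. assert (sc g = 0) by nra.
  apply injective_projections; assumption. }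
unfold moeb. rewrite jfac_I.
apply injective_projections; simpl; field_simplify; auto; f_equal; nra.
Qed.

Lemma slt_mul_factor (g h : SLt) : inSLt g -> inSLt h ->
  jfac (slt_mul g h) Ci = Cmult (jfac g (moeb h Ci)) (jfac h Ci).
Proof.
intros Hg Hh. unfold jfac at 2, moeb.
transitivity (Cplus (Cmult (RtoC (sc g)) (Cplus (Cmult (RtoC (sa h)) Ci) (RtoC (sb h))))
                    (Cmult (RtoC (sd g)) (jfac h Ci))).
- apply injective_projections; simpl; ring.
- field. apply jfac_nonzero, Hh.
Qed.

(* [c w + d] and [c i + d] lie in the same open half plane, or [c = 0]: their quotient avoids
   the cut of [Arg]. *)
Lemma cocycle_arg (g : SLt) (w : C) : inSLt g -> 0 < Im w ->
  is_arg (Arg (Cdiv (jfac g w) (jfac g Ci))) (Cdiv (jfac g w) (jfac g Ci)).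
Proof.
intros Hg Hw. apply Arg_correct.
assert (D := proj1 Hg). destruct w as [x y]. cbn in Hw.
assert (P : 0 < sd g * sd g + sc g * sc g).
{ destruct (Req_dec (sc g) 0) as [E|E]; [rewrite E in *; nra|nra]. }
set (n := sd g * sd g + sc g * sc g) in *.
assert (Er : Re (Cdiv (jfac g (x, y)) (jfac g Ci))
             = ((sc g * x + sd g) * sd g + sc g * sc g * y) / n).
{ rewrite jfac_I. unfold n. unfold Re. simpl. field. unfold n in P. lra. }
assert (Ei : Im (Cdiv (jfac g (x, y)) (jfac g Ci))
             = sc g * (sd g * y - (sc g * x + sd g)) / n).
{ rewrite jfac_I. unfold n. unfold Im. simpl. field. unfold n in P. lra. }
rewrite Er, Ei.
destruct (Req_dec (sc g * (sd g * y - (sc g * x + sd g))) 0) as [E|E].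
- right. apply Rdiv_lt_0_compat; [|exact P].
  apply Rmult_integral in E. destruct E as [E|E].
  + rewrite E in *. assert (sd g <> 0) by (intros F; rewrite F in D; lra). nra.
  + replace (sc g * x + sd g) with (sd g * y) by lra. unfold n in P. nra.
- left. apply Rmult_integral_contrapositive. split; [exact E|].
  apply Rinv_neq_0_compat. lra.
Qed.

Lemma slt_mul_in (g h : SLt) : inSLt g -> inSLt h -> inSLt (slt_mul g h).
Proof.
intros Hg Hh. apply inSLt_alt. split.
- assert (Dg := proj1 Hg). assert (Dh := proj1 Hh). cbn [sa sb sc sd slt_mul].
  transitivity ((sa g * sd g - sb g * sc g) * (sa h * sd h - sb h * sc h));
    [ring|rewrite Dg, Dh; ring].
- rewrite slt_mul_factor by assumption. cbn [sth slt_mul].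
  assert (Iw : 0 < Im (moeb h Ci)).
  { rewrite moeb_I by assumption. cbn. apply Rinv_0_lt_compat.
    assert (D := proj1 Hh). destruct (Req_dec (sc h) 0) as [E|E]; [rewrite E in *; nra|nra]. }
  set (w := moeb h Ci) in *.
  replace (Cmult (jfac g w) (jfac h Ci)) with
    (Cmult (Cmult (jfac g Ci) (jfac h Ci)) (Cdiv (jfac g w) (jfac g Ci)))
    by (field; apply jfac_nonzero, Hg).
  apply is_arg_mul; [|apply cocycle_arg; assumption].
  apply is_arg_mul; [apply (proj1 (inSLt_alt g) Hg)|apply (proj1 (inSLt_alt h) Hh)].
Qed.

(** On the upper half-plane [tauG] corresponds to [z |-> - conj z], and
    [j(tau g, - conj z) = conj j(g, z)]; [Arg] changes sign under conjugation. *)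
Lemma tauG_mul (g h : SLt) : inSLt g -> inSLt h ->
  tauG (slt_mul g h) = slt_mul (tauG g) (tauG h).
Proof.
intros Hg Hh. unfold slt_mul, tauG at 1; cbn [sa sb sc sd sth].
assert (E : Cdiv (jfac (tauG g) (moeb (tauG h) Ci)) (jfac (tauG g) Ci)
            = Cconj (Cdiv (jfac g (moeb h Ci)) (jfac g Ci))).
{ assert (J : forall z, jfac (tauG g) (Copp (Cconj z)) = Cconj (jfac g z)).
  { intros z. apply injective_projections; simpl; ring. }
  rewrite !moeb_I by (try apply tauG_in; assumption). cbn [sa sb sc sd sth tauG].
  replace ((- sb h * sd h + sa h * - sc h) / (sd h * sd h + - sc h * - sc h),
     / (sd h * sd h + - sc h * - sc h)) with
    (Copp (Cconj ((sb h * sd h + sa h * sc h) / (sd h * sd h + sc h * sc h),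
       / (sd h * sd h + sc h * sc h)))).
  - rewrite J. replace (jfac (tauG g) Ci) with (Cconj (jfac g Ci))
      by (rewrite !jfac_I; reflexivity).
    unfold Cdiv. rewrite Cmult_conj. f_equal. symmetry. apply Cinv_conj, jfac_nonzero, Hg.
  - replace (- sc h * - sc h) with (sc h * sc h) by ring.
    apply injective_projections; simpl; unfold Rdiv; ring. }
rewrite E, Arg_conj. unfold tauG; cbn [sa sb sc sd sth]. f_equal; ring.
Qed.

(** Rotations fix [i], so the correction term of the group law is [Arg 1 = 0]. *)
Lemma slt_mul_kt (g : SLt) (t : R) : inSLt g -> slt_mul g (kt t) =
  mkSLt (sa g * cos t + sb g * sin t) (sb g * cos t - sa g * sin t)
        (sc g * cos t + sd g * sin t) (sd g * cos t - sc g * sin t) (sth g + t).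
Proof.
intros Hg. assert (E := sin2_cos2 t). unfold Rsqr in E.
unfold slt_mul. rewrite moeb_I by apply kt_in. cbn [sa sb sc sd sth kt].
replace ((- sin t * cos t + cos t * sin t) / (cos t * cos t + sin t * sin t),
   / (cos t * cos t + sin t * sin t)) with Ci.
2:{ replace (cos t * cos t + sin t * sin t) with 1 by lra.
    apply injective_projections; simpl; field. }
replace (Cdiv (jfac g Ci) (jfac g Ci)) with (RtoC 1) by (field; apply jfac_nonzero, Hg).
rewrite Arg_pos by lra. f_equal; ring.
Qed.

Lemma slt_mul_one : slt_mul slt_one slt_one = slt_one.
Proof.
replace slt_one with (kt 0) by (unfold kt, slt_one; rewrite cos_0, sin_0; f_equal; ring).
rewrite slt_mul_kt by apply kt_in. unfold kt; cbn. rewrite cos_0, sin_0. f_equal; ring.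
Qed.

Lemma kt_add (s t : R) : slt_mul (kt s) (kt t) = kt (s + t).
Proof.
rewrite slt_mul_kt by apply kt_in. unfold kt; cbn. rewrite cos_plus, sin_plus. f_equal; ring.
Qed.

Lemma kt_zero : kt 0 = slt_one.
Proof. unfold kt, slt_one; rewrite cos_0, sin_0; f_equal; ring. Qed.

(** The quotient in the group law is the positive number [r], so the angle is unchanged. The
    equation holds with [r = 1] for diagonal [g] and for [kt PI], and with [r = p * p] for
    [kt (PI / 2)]. *)
Lemma slt_mul_at (g : SLt) (p r : R) : inSLt g -> 0 < p -> 0 < r ->
  jfac g (0, p * p) = Cmult (RtoC r) (jfac g Ci) -> slt_mul g (at_ p) =
  mkSLt (sa g * p) (sb g / p) (sc g * p) (sd g / p) (sth g).
Proof.
intros Hg Hp Hr E. unfold slt_mul. rewrite moeb_I by (apply at_in; exact Hp).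
cbn [sa sb sc sd sth at_].
replace ((0 * / p + p * 0) / (/ p * / p + 0 * 0), / (/ p * / p + 0 * 0)) with (0, p * p)
  by (apply injective_projections; simpl; field; lra).
rewrite E. replace (Cdiv (Cmult r (jfac g Ci)) (jfac g Ci)) with (RtoC r)
  by (field; apply jfac_nonzero, Hg).
rewrite Arg_pos by exact Hr. unfold Rdiv. f_equal; ring.
Qed.

Lemma at_inv (p : R) : 0 < p -> slt_mul (at_ p) (at_ (/ p)) = slt_one.
Proof.
intros Hp. assert (0 < / p) by (apply Rinv_0_lt_compat, Hp).
rewrite slt_mul_at with (r := 1); try apply at_in; try lra.
- unfold at_, slt_one; cbn. f_equal; field; lra.
- apply injective_projections; simpl; ring.
Qed.

(** [kt PI] lifts minus the identity; this commutation makes the forms [<U(a) ., .>] invariant under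
    [W PI]. *)
Lemma kt_PI_central (p : R) : 0 < p -> slt_mul (kt PI) (at_ p) = slt_mul (at_ p) (kt PI).
Proof.
intros Hp. rewrite slt_mul_kt by (apply at_in; exact Hp).
rewrite slt_mul_at with (r := 1); try apply kt_in; try lra.
- unfold at_, kt; cbn. rewrite cos_PI, sin_PI. f_equal; try field; lra.
- unfold jfac, kt; cbn. rewrite cos_PI, sin_PI. apply injective_projections; simpl; ring.
Qed.

Lemma at_conj_weyl (p : R) : 0 < p ->
  slt_mul (slt_mul (kt (PI / 2)) (at_ p)) (kt (- (PI / 2))) = at_ (/ p).
Proof.
intros Hp.
rewrite slt_mul_kt by (apply slt_mul_in; [apply kt_in|apply at_in, Hp]).
rewrite slt_mul_at with (r := p * p); try apply kt_in; try nra.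
- unfold at_, kt; cbn. rewrite cos_neg, sin_neg, cos_PI2, sin_PI2. f_equal; field; lra.
- unfold jfac, kt; cbn. rewrite cos_PI2, sin_PI2. apply injective_projections; simpl; ring.
Qed.

Lemma slt_eta (g : SLt) : g = mkSLt (sa g) (sb g) (sc g) (sd g) (sth g).
Proof. destruct g. reflexivity. Qed.

(** A real matrix acts on the plane as [z |-> alpha z + beta conj z], with [alpha = x1 + i y1] and
    [beta = x2 + i y2]. For [k_s a k_t] their arguments are [s + t] and [s - t], and the singular
    values are [r1 + r2] and [r1 - r2], with product [det = 1]. *)
Lemma slt_kak (g : SLt) : inSLt g -> exists s t p, 0 < p /\
  g = slt_mul (slt_mul (kt s) (at_ p)) (kt t).
Proof.
intros Hg. assert (D := proj1 Hg).
set (x1 := (sa g + sd g) / 2). set (y1 := (sc g - sb g) / 2).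
set (x2 := (sa g - sd g) / 2). set (y2 := (sb g + sc g) / 2).
destruct (polar_exists x1 y1) as [t1 [X1 Y1]].
destruct (polar_exists x2 y2) as [t2 [X2 Y2]].
set (r1 := sqrt (x1 ^ 2 + y1 ^ 2)) in *. set (r2 := sqrt (x2 ^ 2 + y2 ^ 2)) in *.
assert (R10 : 0 <= r1) by apply sqrt_pos. assert (R20 : 0 <= r2) by apply sqrt_pos.
assert (R1 : r1 * r1 = x1 ^ 2 + y1 ^ 2).
{ apply sqrt_sqrt. generalize (pow2_ge_0 x1) (pow2_ge_0 y1). lra. }
assert (R2 : r2 * r2 = x2 ^ 2 + y2 ^ 2).
{ apply sqrt_sqrt. generalize (pow2_ge_0 x2) (pow2_ge_0 y2). lra. }
assert (Q : (r1 + r2) * (r1 - r2) = 1).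
{ transitivity (r1 * r1 - r2 * r2); [ring|]. rewrite R1, R2. unfold x1, x2, y1, y2. lra. }
assert (P : 0 < r1 + r2) by nra.
assert (Pi : / (r1 + r2) = r1 - r2).
{ apply Rmult_eq_reg_l with (r1 + r2); [|lra]. rewrite Q. field. lra. }
set (s := (t1 + t2) / 2). set (t := (t1 - t2) / 2).
assert (T1 : t1 = s + t) by (unfold s, t; field).
assert (T2 : t2 = s - t) by (unfold s, t; field).
set (h := slt_mul (kt s) (at_ (r1 + r2))).
assert (Hh : inSLt h) by (apply slt_mul_in; [apply kt_in|apply at_in, P]).
set (m := slt_mul h (kt t)).
assert (Hm : inSLt m) by (apply slt_mul_in; [exact Hh|apply kt_in]).
rewrite T1, cos_plus in X1. rewrite T1, sin_plus in Y1.
rewrite T2, cos_minus in X2. rewrite T2, sin_minus in Y2.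
assert (Ma : sa m = sa g).
{ transitivity (x1 + x2); [|unfold x1, x2; field]. rewrite X1, X2.
  unfold m, h; cbn. rewrite Pi. ring. }
assert (Mb : sb m = sb g).
{ transitivity (y2 - y1); [|unfold y1, y2; field]. rewrite Y1, Y2.
  unfold m, h; cbn. rewrite Pi. ring. }
assert (Mc : sc m = sc g).
{ transitivity (y1 + y2); [|unfold y1, y2; field]. rewrite Y1, Y2.
  unfold m, h; cbn. rewrite Pi. ring. }
assert (Md : sd m = sd g).
{ transitivity (x1 - x2); [|unfold x1, x2; field]. rewrite X1, X2.
  unfold m, h; cbn. rewrite Pi. ring. }
(* The two lifts of the same matrix differ by a full turn, which is moved into [t]. *)
set (e := sth g - sth m).
destruct (proj1 (inSLt_alt g) Hg) as [_ Ag].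
destruct (proj1 (inSLt_alt m) Hm) as [_ Am].
assert (N0 := jfac_nonzero g Hg).
rewrite jfac_I, Mc, Md, <- jfac_I in Am.
assert (M0 : Cmod (jfac g Ci) <> 0) by (intros E; apply N0, Cmod_eq_0, E).
destruct Ag as [Ag1 Ag2], Am as [Am1 Am2].
rewrite Ag1 in Am1. rewrite Ag2 in Am2.
apply Rmult_eq_reg_l in Am1; [|exact M0]. apply Rmult_eq_reg_l in Am2; [|exact M0].
assert (SC := sin2_cos2 (sth m)). unfold Rsqr in SC.
assert (Ce : cos e = 1) by (unfold e; rewrite cos_minus, Am1, Am2; lra).
assert (Se : sin e = 0) by (unfold e; rewrite sin_minus, Am1, Am2; ring).
exists s, (t + e), (r1 + r2). split; [exact P|]. fold h.
rewrite slt_mul_kt by exact Hh.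
rewrite cos_plus, sin_plus, Ce, Se.
assert (Em : m = mkSLt (sa h * cos t + sb h * sin t) (sb h * cos t - sa h * sin t)
  (sc h * cos t + sd h * sin t) (sd h * cos t - sc h * sin t) (sth h + t))
  by (apply slt_mul_kt, Hh).
assert (Et : sth g = sth h + (t + e)).
{ unfold e. rewrite Em at 1. cbn [sth]. ring. }
transitivity (mkSLt (sa g) (sb g) (sc g) (sd g) (sth g)); [apply slt_eta|].
rewrite <- Ma, <- Mb, <- Mc, <- Md, Et, Em. cbn [sa sb sc sd]. f_equal; ring.
Qed.

Lemma slt_dist_kt (eps : R) : 0 < eps -> exists delta, 0 < delta /\
  forall t, Rabs t < delta -> slt_dist (kt t) (kt 0) < eps.
Proof.
intros He.
assert (Cc : continuity_pt cos 0) by apply continuity_cos.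
assert (Cs : continuity_pt sin 0) by apply continuity_sin.
destruct (Cc (eps / 5)) as [d1 [D1 E1]]; [lra|].
destruct (Cs (eps / 5)) as [d2 [D2 E2]]; [lra|].
exists (Rmin (eps / 5) (Rmin d1 d2)). split.
{ repeat apply Rmin_pos; lra. }
intros t Ht.
assert (H0 : Rabs t < eps / 5) by (eapply Rlt_le_trans; [exact Ht|apply Rmin_l]).
assert (H12 : Rabs t < Rmin d1 d2) by (eapply Rlt_le_trans; [exact Ht|apply Rmin_r]).
assert (H1 : Rabs t < d1) by (eapply Rlt_le_trans; [exact H12|apply Rmin_l]).
assert (H2 : Rabs t < d2) by (eapply Rlt_le_trans; [exact H12|apply Rmin_r]).
assert (F1 : Rabs (cos t - cos 0) < eps / 5).
{ destruct (Req_dec t 0) as [->|N]; [rewrite Rminus_diag, Rabs_R0; lra|].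
  apply E1. split; [split; [exact I|auto]|]. simpl. unfold R_dist. rewrite Rminus_0_r. exact H1. }
assert (F2 : Rabs (sin t - sin 0) < eps / 5).
{ destruct (Req_dec t 0) as [->|N]; [rewrite Rminus_diag, Rabs_R0; lra|].
  apply E2. split; [split; [exact I|auto]|]. simpl. unfold R_dist. rewrite Rminus_0_r. exact H2. }
unfold slt_dist, kt; cbn [sa sb sc sd sth].
replace (- sin t - - sin 0) with (- (sin t - sin 0)) by ring.
rewrite Rabs_Ropp, (Rminus_0_r t). lra.
Qed.

(** * The conjugation *)

(** The condition involves two elements at a time, so it survives unions of chains and Zorn's lemma
    applies. *)
Lemma maximal_clique {T : Type} (Q : T -> T -> Prop) : exists S : T -> Prop,
  (forall v w, S v -> S w -> Q v w) /\
  (forall u, Q u u -> (forall v, S v -> Q u v /\ Q v u) -> S u).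
Proof.
destruct (@classical_sets.Zorn_bigcup T (fun S => forall v w, S v -> S w -> Q v w))
  as [S [HS Max]].
- intros F FP tot v w [X FX Xv] [Y FY Yw].
  destruct (tot X Y FX FY) as [XY|YX].
  + apply (FP Y FY); auto.
  + apply (FP X FX); auto.
- exists S. split; [exact HS|]. intros u Quu Qu. apply NNPP. intros nSu.
  apply (Max (fun x => S x \/ x = u)).
  + split; [intros x Sx; left; exact Sx|].
    intros Hsub. apply nSu, Hsub. right. reflexivity.
  + intros v w [Sv| ->] [Sw| ->]; auto; apply Qu; assumption.
Qed.

(** Real orthogonality to a complex subspace is complex orthogonality, because [D] contains [hI x]
    along with [x]; hence the complement is again complex. *)
Lemma csub_orth {H : HilbertSpace} (D : H -> Prop) : csub D ->
  csub (fun z => forall x, D x -> rip x z = 0).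
Proof.
intros C. split.
- intros x _. apply rip_zero_r.
- intros y z Hy Hz x Dx. rewrite rip_add_r, Hy, Hz by exact Dx. ring.
- intros a z Hz x Dx. rewrite hscal_split. autorewrite with rip. rewrite (Hz x Dx).
  replace (rip x (hI z)) with (- rip (hI x) z) by (rewrite rip_hI_l; ring).
  rewrite (Hz (hI x)) by (apply csub_hI; assumption). ring.
- intros u l Hu L x Dx.
  assert (E := is_lim_seq_unique _ _ (tends_rip _ _ _ _ (tends_const x) L)).
  rewrite (Lim_seq_ext _ (fun _ => 0)), Lim_seq_const in E by (intros n; apply Hu, Dx).
  injection E. auto.
Qed.

Lemma hnorm_sub_eq {H : HilbertSpace} (x y : H) : hnorm H (hsub x y) = 0 -> x = y.
Proof. intros E. apply hsub_eq, hnorm_def, E. Qed.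

Lemma hinner_conj_iff {H : HilbertSpace} (x y x' y' : H) :
  hinner H y y' = Cconj (hinner H x x') <->
  rip y y' = rip x x' /\ rip y (hI y') = - rip x (hI x').
Proof.
rewrite <- !Im_hinner. unfold rip.
destruct (hinner H y y') as [a b], (hinner H x x') as [c d]. simpl. split.
- intros E. injection E. auto.
- intros [-> ->]. reflexivity.
Qed.

Section Representation.

Context {H : HilbertSpace} (U : SLt -> H -> H).
Hypothesis RU : unitary_rep H U.

Lemma rep_linop (g : SLt) : inSLt g -> linop (U g).
Proof. intros Hg. destruct (proj1 RU g Hg) as [A [S _]]. split; assumption. Qed.

Lemma rep_hinner (g : SLt) (x y : H) : inSLt g -> hinner H (U g x) (U g y) = hinner H x y.
Proof. intros Hg. apply (proj1 RU g Hg). Qed.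

Lemma rep_rip (g : SLt) (x y : H) : inSLt g -> rip (U g x) (U g y) = rip x y.
Proof. intros Hg. unfold rip. rewrite rep_hinner by exact Hg. reflexivity. Qed.

Lemma rep_norm (g : SLt) (x : H) : inSLt g -> hnorm H (U g x) = hnorm H x.
Proof. intros Hg. apply hnorm_eq, rep_rip, Hg. Qed.

Lemma rep_mul (g h : SLt) (x : H) : inSLt g -> inSLt h -> U (slt_mul g h) x = U g (U h x).
Proof. apply (proj1 (proj2 RU)). Qed.

(** [unitary_rep] asks only for multiplicativity, but a linear idempotent isometry is the
    identity. *)
Lemma rep_one (x : H) : U slt_one x = x.
Proof.
assert (H1 : inSLt slt_one) by (rewrite <- kt_zero; apply kt_in).
apply hnorm_sub_eq. rewrite <- (rep_norm slt_one) by exact H1.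
rewrite (linop_sub (U slt_one)) by (apply rep_linop, H1).
rewrite <- rep_mul, slt_mul_one by exact H1. unfold hsub. rewrite hadd_opp. apply hnorm_zero.
Qed.

Lemma rep_unitary_group : unitary_group (fun t => U (kt t)).
Proof.
split.
- intros t. apply rep_linop, kt_in.
- intros t x y. apply rep_rip, kt_in.
- intros x. rewrite kt_zero. apply rep_one.
- intros s t x. rewrite <- kt_add. apply rep_mul; apply kt_in.
- intros x eps He.
  destruct (proj2 (proj2 RU) (kt 0) x (kt_in 0) eps He) as [d [Hd D]].
  destruct (slt_dist_kt d Hd) as [e [He' E]]. exists e. split; [exact He'|].
  intros t Ht. specialize (D (kt t) (kt_in t) (E t Ht)).
  rewrite kt_zero, rep_one in D. exact D.
Qed.

Let W (t : R) : H -> H := U (kt t).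
Let UW : unitary_group W := rep_unitary_group.

Lemma rep_at_inv (p : R) (x : H) : 0 < p -> U (at_ p) (U (at_ (/ p)) x) = x.
Proof.
intros Hp. assert (0 < / p) by (apply Rinv_0_lt_compat, Hp).
rewrite <- rep_mul, at_inv by (try apply at_in; assumption). apply rep_one.
Qed.

(** A conjugation [J] with [J U(g) = U(tau g) J] forces this on any two of its fixed vectors, since
    [<U(tau g) v, w> = <J U(g) v, J w>]. *)
Definition tau_symmetric (v w : H) : Prop := forall g, inSLt g ->
  hinner H (U (tauG g) v) w = Cconj (hinner H (U g v) w).

Lemma sform_at (p : R) : 0 < p -> sform (fun x y => rip (U (at_ p) x) y).
Proof.
intros Hp. assert (L := rep_linop _ (at_in p Hp)). split.
- intros. rewrite (linop_add _ L). apply rip_add_l.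
- intros. apply rip_add_r.
- intros. rewrite (linop_rscal _ _ _ L). apply rip_rscal_l.
- intros. apply rip_rscal_r.
- intros. rewrite (linop_hI _ _ L). apply rip_hI_l.
- intros. rewrite <- (rep_norm (at_ p) x) by (apply at_in, Hp). apply cauchy_schwarz.
Qed.

(* With [g = k_s a k_t], [tau g = k_{-s} a k_{-t}] and [a^-1 = k_{pi/2} a k_{-pi/2}], both
   sides are values of the form [<U(a) ., .>] at points of the [K]-orbit of [(v, v)] that
   differ by one rotation. *)
Lemma rigid_tau_symmetric (N : H -> Prop) : winv W N ->
  (forall c, sform c -> (forall x y, c (W PI x) (W PI y) = c x y) ->
     forall t x y, N x -> N y -> c (W t x) (W t y) = c x y) ->
  forall v, N v -> tau_symmetric v v.
Proof.
intros [cN wN] rigid v Nv g Hg.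
destruct (slt_kak g Hg) as [s [t [p [Hp E]]]].
assert (Ha := at_in p Hp).
assert (Inv : forall r x y, N x -> N y ->
  hinner H (U (at_ p) (W r x)) (W r y) = hinner H (U (at_ p) x) y).
{ assert (I : forall r x y, N x -> N y ->
    rip (U (at_ p) (W r x)) (W r y) = rip (U (at_ p) x) y).
  { apply (rigid (fun x y => rip (U (at_ p) x) y)); [apply sform_at, Hp|].
    intros x y. unfold W.
    rewrite <- (rep_mul (at_ p)), <- kt_PI_central, rep_mul, rep_rip
      by (try apply kt_in; assumption). reflexivity. }
  intros r x y Nx Ny. apply hinner_ext; [apply I; assumption|].
  rewrite <- (linop_hI (W r)) by (apply rep_linop, kt_in).
  apply I; [assumption|apply csub_hI; assumption]. }
assert (Ug : U g v = W s (U (at_ p) (W t v))).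
{ rewrite E, !rep_mul by (try apply slt_mul_in; try apply kt_in; assumption). reflexivity. }
assert (Utg : U (tauG g) v = W (- s) (U (at_ p) (W (- t) v))).
{ rewrite E, !tauG_mul, !tauG_kt, tauG_at, !rep_mul
    by (try apply slt_mul_in; try apply kt_in; assumption). reflexivity. }
assert (Wadj : forall r x y, hinner H (W r x) y = hinner H x (W (- r) y)).
{ intros r x y. rewrite <- (ug_inv' W UW r y) at 1. apply rep_hinner, kt_in. }
assert (Hai : inSLt (at_ (/ p))) by (apply at_in, Rinv_0_lt_compat, Hp).
rewrite Ug, Utg, <- hinner_conj, !Wadj, Ropp_involutive.
rewrite <- (Ropp_involutive s) at 2. rewrite <- Wadj.
rewrite <- (rep_at_inv p (W (- s) v)) at 1 by exact Hp.
rewrite rep_hinner by exact Ha. rewrite <- at_conj_weyl by exact Hp.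
rewrite !rep_mul by (try apply slt_mul_in; try apply kt_in; assumption).
change (U (kt ?r)) with (W r). rewrite Wadj, <- !(ug_add W UW).
(* The angle that carries [- t] to [- s - PI / 2] also carries [s] to [t - PI / 2]. *)
rewrite <- (Inv (t - s - PI / 2) (W (- t) v) (W s v)) by auto.
rewrite <- !(ug_add W UW).
replace (t - s - PI / 2 + - t) with (- (PI / 2) + - s) by ring.
replace (t - s - PI / 2 + s) with (- (PI / 2) + t) by ring. reflexivity.
Qed.

(** Inverts the three factors of K A K; as [tauG] acts factorwise, the same [h'] serves the [tauG]
    images as well. *)
Lemma rep_left_inverse (h : SLt) : inSLt h -> exists h', inSLt h' /\
  forall x, U h' (U h x) = x /\ U (tauG h') (U (tauG h) x) = x.
Proof.
intros Hh. destruct (slt_kak h Hh) as [s [t [p [Hp E]]]].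
assert (Hp' : 0 < / p) by (apply Rinv_0_lt_compat, Hp).
assert (Ha := at_in p Hp). assert (Ha' := at_in _ Hp').
exists (slt_mul (slt_mul (kt (- t)) (at_ (/ p))) (kt (- s))).
split; [repeat apply slt_mul_in; try apply kt_in; assumption|].
intros x. rewrite E.
rewrite !tauG_mul, !tauG_kt, !tauG_at, !rep_mul
  by (try apply slt_mul_in; try apply kt_in; assumption).
change (U (kt ?r)) with (W r). rewrite !(ug_inv W UW).
assert (A : forall y, U (at_ (/ p)) (U (at_ p) y) = y).
{ intros y. rewrite <- (Rinv_inv p) at 2. apply rep_at_inv, Hp'. }
rewrite !A, !(ug_inv W UW). auto.
Qed.

(* The closed graph of the antilinear map [U(g) v |-> U(tau g) v] for [v] in [S]. *)
Inductive tau_graph (S : H -> Prop) : H -> H -> Prop :=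
| tau_graph_gen g v : inSLt g -> S v -> tau_graph S (U g v) (U (tauG g) v)
| tau_graph_zero : tau_graph S (hzero H) (hzero H)
| tau_graph_add x y x' y' : tau_graph S x y -> tau_graph S x' y' ->
    tau_graph S (hadd H x x') (hadd H y y')
| tau_graph_scal a x y : tau_graph S x y ->
    tau_graph S (hscal H a x) (hscal H (Cconj a) y)
| tau_graph_lim u v l m : (forall n, tau_graph S (u n) (v n)) ->
    tends u l -> tends v m -> tau_graph S l m.

(** * The antiunitary map determined by pairwise symmetric vectors *)

Section Graph.

Context (S : H -> Prop).
Hypothesis symS : forall v w, S v -> S w -> tau_symmetric v w.

(** Both sides are additive, scale alike and are continuous along the graph, so the generators
    decide. It is applied once for each argument of the inner product. *)
Lemma tau_graph_conj_left (x y x' y' : H) :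
  (forall g v, inSLt g -> S v ->
     hinner H (U (tauG g) v) y' = Cconj (hinner H (U g v) x')) ->
  tau_graph S x y -> hinner H y y' = Cconj (hinner H x x').
Proof.
intros Gen G.
induction G as [g v Hg Sv| |x y z w G1 IH1 G2 IH2|a x y G IH|u v l m G IH Lu Lv].
- apply Gen; assumption.
- apply hinner_conj_iff. rewrite !rip_zero_l. split; ring.
- rewrite !hinner_add_l, IH1, IH2. symmetry. apply Cplus_conj.
- rewrite !hinner_scal_l, IH. symmetry. apply Cmult_conj.
- assert (Lim : forall z z' r, (forall n, rip (v n) z = r * rip (u n) z') ->
    rip m z = r * rip l z').
  { intros z z' r E.
    assert (A : is_lim_seq (fun n => r * rip (u n) z') (rip m z)).
    { apply is_lim_seq_ext with (fun n => rip (v n) z); [exact E|].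
      exact (tends_rip _ _ _ _ Lv (tends_const z)). }
    assert (B : is_lim_seq (fun n => r * rip (u n) z') (r * rip l z')).
    { apply (is_lim_seq_scal_l _ r (rip l z')).
      exact (tends_rip _ _ _ _ Lu (tends_const z')). }
    apply is_lim_seq_unique in A. apply is_lim_seq_unique in B.
    rewrite A in B. injection B. auto. }
  apply hinner_conj_iff. split.
  + rewrite (Lim y' x' 1); [ring|].
    intros n. destruct (proj1 (hinner_conj_iff _ _ _ _) (IH n)). lra.
  + rewrite (Lim (hI y') (hI x') (-1)); [ring|].
    intros n. destruct (proj1 (hinner_conj_iff _ _ _ _) (IH n)). lra.
Qed.

Lemma tau_graph_conj (x y x' y' : H) :
  tau_graph S x y -> tau_graph S x' y' -> hinner H y y' = Cconj (hinner H x x').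
Proof.
intros G G'. apply tau_graph_conj_left; [|exact G].
intros g v Hg Sv. rewrite hinner_conj, (hinner_conj H x'). f_equal.
apply tau_graph_conj_left; [|exact G'].
intros h w Hh Sw.
(* Moving [U g] to the other side leaves a matrix coefficient of [g' h], to which symmetry
   applies. *)
destruct (rep_left_inverse g Hg) as [g' [Hg' E]].
rewrite <- (rep_hinner (tauG g')), <- (rep_hinner g' (U h w))
  by (try apply tauG_in; assumption).
rewrite (proj1 (E v)), (proj2 (E v)).
rewrite <- !rep_mul, <- tauG_mul by (try apply tauG_in; assumption).
apply symS; [assumption|assumption|]. apply slt_mul_in; assumption.
Qed.

Lemma tau_graph_sub (x y x' y' : H) :
  tau_graph S x y -> tau_graph S x' y' -> tau_graph S (hsub x x') (hsub y y').
Proof.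
intros G G'. unfold hsub. rewrite <- !rscal_m1. apply tau_graph_add; [exact G|].
replace (rscal (-1) y') with (hscal H (Cconj (RtoC (-1))) y').
- apply tau_graph_scal, G'.
- unfold rscal. f_equal. apply injective_projections; simpl; ring.
Qed.

Lemma tau_graph_norm (x y : H) : tau_graph S x y -> hnorm H y = hnorm H x.
Proof.
intros G. apply hnorm_eq. apply (proj1 (hinner_conj_iff _ _ _ _) (tau_graph_conj _ _ _ _ G G)).
Qed.

Lemma tau_graph_fun (x y y' : H) : tau_graph S x y -> tau_graph S x y' -> y = y'.
Proof.
intros G G'. apply hnorm_sub_eq.
rewrite (tau_graph_norm _ _ (tau_graph_sub _ _ _ _ G G')).
unfold hsub. rewrite hadd_opp. apply hnorm_zero.
Qed.

Lemma tau_graph_sym (x y : H) : tau_graph S x y -> tau_graph S y x.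
Proof.
intros G.
induction G as [g v Hg Sv| |x y z w G1 IH1 G2 IH2|a x y G IH|u v l m G IH Lu Lv].
- rewrite <- (tauG_tauG g) at 2. apply tau_graph_gen; [apply tauG_in|]; assumption.
- apply tau_graph_zero.
- apply tau_graph_add; assumption.
- rewrite <- (Cconj_conj a) at 2. apply tau_graph_scal, IH.
- apply tau_graph_lim with v u; assumption.
Qed.

Lemma tends_rep (h : SLt) (u : nat -> H) (l : H) : inSLt h -> tends u l ->
  tends (fun n => U h (u n)) (U h l).
Proof.
intros Hh. apply tends_lip with (c := 1). intros n.
rewrite <- linop_sub, rep_norm by (try apply rep_linop; exact Hh). lra.
Qed.

Lemma tau_graph_equivariant (h : SLt) (x y : H) : inSLt h -> tau_graph S x y ->
  tau_graph S (U h x) (U (tauG h) y).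
Proof.
intros Hh G. assert (Ht := tauG_in h Hh).
assert (L := rep_linop h Hh). assert (Lt := rep_linop _ Ht).
induction G as [g v Hg Sv| |x y z w G1 IH1 G2 IH2|a x y G IH|u v l m G IH Lu Lv].
- rewrite <- !rep_mul, <- tauG_mul by (try apply tauG_in; assumption).
  apply tau_graph_gen; [apply slt_mul_in|]; assumption.
- assert (Z : forall T : H -> H, linop T -> T (hzero H) = hzero H).
  { intros T LT. replace (hzero H) with (rscal 0 (hzero H)) at 1 by hvec.
    rewrite linop_rscal by exact LT. hvec. }
  rewrite !Z by assumption. apply tau_graph_zero.
- rewrite (linop_add _ L), (linop_add _ Lt). apply tau_graph_add; assumption.
- rewrite (linop_scal _ L), (linop_scal _ Lt). apply tau_graph_scal, IH.
- apply tau_graph_lim with (fun n => U h (u n)) (fun n => U (tauG h) (v n));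
    [exact IH|apply tends_rep; assumption|apply tends_rep; assumption].
Qed.

Definition tau_dom (x : H) : Prop := exists y, tau_graph S x y.

(** The graph is isometric, so the images of a convergent sequence converge, and the graph is
    closed. *)
Lemma tau_dom_csub : csub tau_dom.
Proof.
split.
- exists (hzero H). apply tau_graph_zero.
- intros x x' [y G] [y' G']. exists (hadd H y y'). apply tau_graph_add; assumption.
- intros a x [y G]. exists (hscal H (Cconj a) y). apply tau_graph_scal, G.
- intros u l D L. destruct (choice (fun n y => tau_graph S (u n) y) D) as [v G].
  destruct (cauchy_tends v) as [m Lv].
  + intros eps He. destruct (tends_cauchy u l L eps He) as [n0 Hn].
    exists n0. intros p q Hp Hq.
    rewrite (tau_graph_norm _ _ (tau_graph_sub _ _ _ _ (G p) (G q))). auto.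
  + exists m. apply tau_graph_lim with u v; assumption.
Qed.

Hypothesis maxS : forall u, tau_symmetric u u ->
  (forall v, S v -> tau_symmetric u v /\ tau_symmetric v u) -> S u.

(** Otherwise the complement of the domain contains a nonzero vector [v] of a rigid subspace. Its
    mixed coefficients with [S] vanish, so maximality puts [v] into [S], hence into the domain, and
    [v] is orthogonal to itself. *)
Lemma tau_dom_full (x : H) : tau_dom x.
Proof.
apply csub_full; [apply tau_dom_csub|]. clear x. intros z Hz. apply NNPP. intros z0.
set (O := fun z => forall x, tau_dom x -> rip x z = 0).
assert (cO : csub O) by apply csub_orth, tau_dom_csub.
assert (UO : forall g y, inSLt g -> O y -> O (U g y)).
{ intros g y Hg Oy x [x' G]. destruct (rep_left_inverse g Hg) as [g' [Hg' E]].
  rewrite <- (rep_rip g'), (proj1 (E y)) by exact Hg'.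
  apply Oy. exists (U (tauG g') x'). apply tau_graph_equivariant; assumption. }
assert (iO : winv W O) by (split; [exact cO|intros t y; apply UO, kt_in]).
assert (SD : forall w, S w -> tau_dom w).
{ intros w Sw. exists (U (tauG slt_one) w). rewrite <- (rep_one w) at 1.
  apply tau_graph_gen; [rewrite <- kt_zero; apply kt_in|exact Sw]. }
assert (O0 : forall y w, O y -> tau_dom w -> hinner H w y = RtoC 0).
{ intros y w Oy Dw. assert (E1 := Oy w Dw).
  assert (E2 := csub_hI O y cO Oy w Dw). rewrite <- Im_hinner in E2.
  apply injective_projections; assumption. }
destruct (rigid_subspace W UW O iO (ex_intro _ z (conj Hz z0)))
  as [N [NO [iN [[v [Nv v0]] rigid]]]].
assert (Sv : S v).
{ apply maxS; [apply (rigid_tau_symmetric N iN rigid v Nv)|].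
  intros w Sw.
  assert (Z : forall g, inSLt g -> hinner H (U g w) v = RtoC 0 /\ hinner H (U g v) w = RtoC 0).
  { intros g Hg. split.
    - apply O0; [auto|]. exists (U (tauG g) w). apply tau_graph_gen; assumption.
    - rewrite hinner_conj, O0 by auto. apply injective_projections; simpl; ring. }
  split; intros g Hg; destruct (Z g Hg) as [Z1 Z2];
    destruct (Z (tauG g) (tauG_in g Hg)) as [Z3 Z4].
  - rewrite Z2, Z4. apply injective_projections; simpl; ring.
  - rewrite Z1, Z3. apply injective_projections; simpl; ring. }
apply v0, rip_def, (NO v Nv), SD, Sv.
Qed.

End Graph.

Lemma conjugation_exists : exists J : H -> H, antiunitary H J /\
  (forall x, J (J x) = x) /\ (forall g x, inSLt g -> J (U g x) = U (tauG g) (J x)).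
Proof.
destruct (maximal_clique tau_symmetric) as [S [symS maxS]].
destruct (choice (tau_graph S) (tau_dom_full S symS maxS)) as [J G].
assert (Fun : forall x y, tau_graph S x y -> J x = y)
  by (intros x y; apply (tau_graph_fun S symS), G).
assert (Inv : forall x, J (J x) = x) by (intros x; apply Fun, tau_graph_sym, G).
exists J. repeat split.
- intros x y. apply Fun, tau_graph_add; apply G.
- intros a x. apply Fun, tau_graph_scal, G.
- intros y. exists (J y). apply Inv.
- intros x y. apply (tau_graph_conj S symS); apply G.
- exact Inv.
- intros g x Hg. apply Fun, tau_graph_equivariant; [exact Hg|apply G].
Qed.

End Representation.

Theorem theorem4p25 :
  forall (H : HilbertSpace) (U : SLt -> H -> H),
    unitary_rep H U ->
    exists V : GLt -> H -> H,
      antiunitary_rep H V /\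
      (forall g (v : H), inSLt g -> V (g, false) v = U g v).
Proof.
intros H U RU.
destruct (conjugation_exists U RU) as [J [[Ja [Js [_ Jc]]] [JJ JU]]].
(* [tau_G] acts as [J]; [JJ] and [JU] are the relations of the semidirect product. *)
exists (fun (x : GLt) v => U (fst x) (if snd x then J v else v)).
split; [split; [|split]|reflexivity].
- intros g Hg. destruct (proj1 RU g Hg) as [Ua [Us [Ut Uc]]].
  split; [exact (proj1 RU g Hg)|]. simpl. repeat split.
  + intros x y. rewrite Ja. apply Ua.
  + intros a x. rewrite Js. apply Us.
  + intros y. destruct (Ut y) as [x E]. exists (J x). rewrite JJ. exact E.
  + intros x y. rewrite Uc. apply Jc.
- intros [g s] [h r] v Hg Hh. unfold inGLt in Hg, Hh. simpl in *.
  destruct s; simpl.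
  + rewrite (rep_mul U RU), JU by (try apply tauG_in; assumption).
    destruct r; simpl; [rewrite JJ|]; reflexivity.
  + rewrite (rep_mul U RU) by assumption. reflexivity.
- intros s g v Hg. exact (proj2 (proj2 RU) g (if s then J v else v) Hg).
Qed.
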